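(* Let $\mathcal U$ be an upper cluster algebra with principal coefficients at $t_0$ and let $A_{k;t}$ be a non-initial cluster variable of $\mathcal U$ (i.e. $A_{k;t}\notin\{A_{1;t_0},\ldots,A_{n;t_0}\}$). Then the $F$-polynomial $F_{k;t}$ of $A_{k;t}$ is irreducible in $\mathbb K[Z_1,\ldots,Z_n]$.
   Context: Throughout, $\mathbb K$ is a factorial domain (UFD) of characteristic $0$. A semifield $(\mathbb P,\oplus,\cdot)$ is an abelian multiplicative group with a commutative, associative operation $\oplus$ over which multiplication distributes; $\mathbb{KP}$ is its group ring over $\mathbb K$, and $\mathcal F$ is the field of rational functions in $n$ independent variables with coefficients in $\mathbb{KP}$. An integer $n\times n$ matrix $B$ is skew-symmetrizable if $SB$ is skew-symmetric for some integer diagonal matrix $S$ with positive diagonal entries. A (labeled) $\mathscr A$-seed over $\mathbb P$ is a triple $(B,X,A)$ with $B=(b_{ij})$ an $n\times n$ skew-symmetrizable integer matrix, $X=(X_1,\ldots,X_n)\in\mathbb P^n$, and $A=(A_1,\ldots,A_n)$ a free generating set of $\mathcal F$ over $\mathbb{KP}$. Its $k$-th exchange binomial is $P_k=\frac{X_k}{1\oplus X_k}\prod_{b_{jk}>0}A_j^{b_{jk}}+\frac{1}{1\oplus X_k}\prod_{b_{jk}<0}A_j^{-b_{jk}}$. The mutation $\mu_k(B,X,A)=(B',X',A')$ is: $b'_{ij}=-b_{ij}$ if $i=k$ or $j=k$, else $b'_{ij}=b_{ij}+\mathrm{sgn}(b_{ik})\max(b_{ik}b_{kj},0)$; $X'_k=X_k^{-1}$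 and $X'_i=X_iX_k^{\max(b_{ki},0)}(1\oplus X_k)^{-b_{ki}}$ for $i\ne k$; $A'_i=A_i$ for $i\neq k$ and $A'_k=A_k^{-1}P_k$. Let $\mathbb T_n$ be the $n$-regular tree with edges labeled $1,\ldots,n$ so that edges at each vertex have distinct labels. An $\mathscr A$-seed pattern assigns to each vertex $t$ a seed $(B_t,X_t,A_t)$, $B_t=(b^t_{ij})$, $X_t=(X_{1;t},\ldots,X_{n;t})$, $A_t=(A_{1;t},\ldots,A_{n;t})$, such that seeds at vertices joined by an edge labeled $k$ are related by $\mu_k$. A vertex $t_0$ is chosen as initial. The upper cluster algebra is $\mathcal U=\bigcap_{t}\mathbb{KP}[A_{1;t}^{\pm1},\ldots,A_{n;t}^{\pm1}]$. The $A_{k;t}$ are the cluster variables (they lie in $\mathcal U$). Principal coefficients at $t_0$: $\mathbb P=\mathrm{Trop}(Z_1,\ldots,Z_n)$, the free abelian group on $Z_1,\ldots,Z_n$ with $\prod Z_i^{a_i}\oplus\prod Z_i^{b_i}=\prod Z_i^{\min(a_i,b_i)}$, and $X_{i;t_0}=Z_i$ for $i=1,\ldots,n$. In this case every cluster variable $A_{k;t}$ lies in $\mathbb Z[Z_1,\ldots,Z_n][A_{1;t_0}^{\pm1},\ldots,A_{n;t_0}^{\pm1}]$ (known), and its $F$-polynomial is $F_{k;t}(Z_1,\ldots,Z_n):=A_{k;t}|_{A_{1;t_0}=\cdots=A_{n;t_0}=1}\in\mathbb Z[Z_1,\ldots,Z_n]\subseteq\mathbb K[Z_1,\ldots,Z_n]$.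 *)

(* Defs.v *)
From HB Require Import structures.
From mathcomp Require Import all_boot all_order all_algebra.
From mathcomp Require Import mpoly.
From Stdlib Require Import ClassicalEpsilon.

Set Implicit Arguments.
Unset Strict Implicit.
Unset Printing Implicit Defensive.

Import Order.TTheory GRing.Theory Num.Theory.
Local Open Scope ring_scope.

(* Factorial domains. *)

Definition irreducible (R : idomainType) (x : R) : Prop :=
  [/\ x != 0, x \isn't a GRing.unit &
      forall a b : R, x = a * b -> a \is a GRing.unit \/ b \is a GRing.unit].

Definition associated (R : idomainType) (x y : R) : Prop :=
  exists2 u : R, u \is a GRing.unit & y = u * x.

Definition factorial_domain (R : idomainType) : Prop :=
  (forall x : R, x != 0 -> x \isn't a GRing.unit ->
     exists2 s : seq R, {in s, forall y, irreducible y} & x = \prod_(y <- s) y)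
  /\
  (forall s1 s2 : seq R,
     {in s1, forall y, irreducible y} -> {in s2, forall y, irreducible y} ->
     associated (\prod_(y <- s1) y) (\prod_(y <- s2) y) ->
     exists2 s3 : seq R, perm_eq s2 s3 &
       size s1 = size s3 /\
       forall i, (i < size s1)%N -> associated s1`_i s3`_i).

(* Semifields: the group law is MathComp's multiplicative [groupType]. *)

HB.mixin Record Group_isSemifield P of Group P := {
  oplus : P -> P -> P;
  smulC : forall x y : P, (x * y = y * x)%g;
  oplusC : commutative oplus;
  oplusA : associative oplus;
  smul_oplusr : forall x y z : P, (x * oplus y z = oplus (x * y) (x * z))%g
}.

#[short(type="semifieldType")]
HB.structure Definition Semifield := {P of Group_isSemifield P & Group P}.

Definition expgz (G : groupType) (x : G) (z : int) : G :=
  match z with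
  | Posz m => (x ^+ m)%g
  | Negz m => (x ^- m.+1)%g
  end.

(* Trop(Z_1, ..., Z_n): an element is the exponent vector of a monomial in
   the Z_i, so the product of monomials is the sum of exponents. *)

Definition trop (n : nat) : Type := {ffun 'I_n -> int}.

Section Tropical.
Variable n : nat.

HB.instance Definition _ := Choice.on (trop n).

Definition trop_one : trop n := [ffun => 0].
Definition trop_mul (x y : trop n) : trop n := [ffun i => x i + y i].
Definition trop_inv (x : trop n) : trop n := [ffun i => - x i].
Definition trop_oplus (x y : trop n) : trop n := [ffun i => Num.min (x i) (y i)].
Definition trop_gen (i : 'I_n) : trop n := [ffun j => (i == j)%:Z].

Fact trop_mulA : associative trop_mul.
Proof. by move=> x y z; apply/ffunP => i; rewrite !ffunE addrA. Qed.

Fact trop_mul1 : left_id trop_one trop_mul.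
Proof. by move=> x; apply/ffunP => i; rewrite !ffunE add0r. Qed.

Fact trop_mulC : commutative trop_mul.
Proof. by move=> x y; apply/ffunP => i; rewrite !ffunE addrC. Qed.

Fact trop_mul1r : right_id trop_one trop_mul.
Proof. by move=> x; rewrite trop_mulC trop_mul1. Qed.

Fact trop_mulV : left_inverse trop_one trop_inv trop_mul.
Proof. by move=> x; apply/ffunP => i; rewrite !ffunE addNr. Qed.

Fact trop_mulVr : right_inverse trop_one trop_inv trop_mul.
Proof. by move=> x; rewrite trop_mulC trop_mulV. Qed.

HB.instance Definition _ := isGroup.Build (trop n)
  trop_mulA trop_mul1 trop_mul1r trop_mulV trop_mulVr.

Fact trop_oplusC : commutative trop_oplus.
Proof. by move=> x y; apply/ffunP => i; rewrite !ffunE minC. Qed.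

Fact trop_oplusA : associative trop_oplus.
Proof. by move=> x y z; apply/ffunP => i; rewrite !ffunE minA. Qed.

Fact trop_mul_oplusr (x y z : trop n) :
  (x * trop_oplus y z = trop_oplus (x * y) (x * z))%g.
Proof. by apply/ffunP => i; rewrite !ffunE addr_minr. Qed.

HB.instance Definition _ := Group_isSemifield.Build (trop n)
  trop_mulC trop_oplusC trop_oplusA trop_mul_oplusr.

End Tropical.

(* An ambient field over KP: a field containing K and P, with the elements of
   P linearly independent over K, so that it contains the group ring KP.
   That it is the field of rational functions in n variables over KP is then
   the existence of a free generating set, which is part of every seed. *)

Record ambientField (K : idomainType) (P : semifieldType) := AmbientField {
  ambient_field :> fieldType;
  scal : {rmorphism K -> ambient_field};
  coef : P -> ambient_field;
  coef1 : coef 1%g = 1;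
  coefM : forall x y : P, coef (x * y)%g = coef x * coef y;
  coef_free : forall (s : seq P) (c : P -> K), uniq s ->
    \sum_(x <- s) scal (c x) * coef x = 0 -> {in s, forall x, c x = 0}
}.

Arguments scal {K P} a.
Arguments coef {K P} a.

Section Seeds.
Variables (K : idomainType) (P : semifieldType) (F : ambientField K P).
Variable n : nat.

Definition in_KP (a : F) : Prop :=
  exists (s : seq P) (c : P -> K), a = \sum_(x <- s) scal F (c x) * coef F x.

Definition over_KP (p : {mpoly F[n]}) : Prop := forall m, in_KP p@_m.

Definition free_generating (A : 'I_n -> F) : Prop :=
  (forall p : {mpoly F[n]}, over_KP p -> p.@[A] = 0 -> p = 0)
  /\
  (forall a : F, exists p q : {mpoly F[n]},
     [/\ over_KP p, over_KP q, q.@[A] != 0 & a = p.@[A] / q.@[A]]).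

Definition skew_symmetrizable (B : 'M[int]_n) : Prop :=
  exists2 d : 'rV[int]_n, (forall i, 0 < d 0 i) &
    (diag_mx d *m B)^T = - (diag_mx d *m B).

Record seed_data := SeedData {
  seedB : 'M[int]_n;
  seedX : {ffun 'I_n -> P};
  seedA : {ffun 'I_n -> F}
}.

Definition is_seed (s : seed_data) : Prop :=
  skew_symmetrizable (seedB s) /\ free_generating (seedA s).

Definition exchange_binomial (s : seed_data) (k : 'I_n) : F :=
  let: SeedData B X A := s in
  coef F (X k * (oplus 1 (X k))^-1)%g * \prod_(j | 0 < B j k) A j ^ B j k
  + coef F ((oplus 1 (X k))^-1)%g * \prod_(j | B j k < 0) A j ^ (- B j k).

Definition mutate (k : 'I_n) (s : seed_data) : seed_data :=
  let: SeedData B X A := s in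
  SeedData
    (\matrix_(i, j)
       if (i == k) || (j == k) then - B i j
       else B i j + Num.sg (B i k) * Num.max (B i k * B k j) 0)
    [ffun i =>
       if i == k then ((X k)^-1)%g
       else (X i * expgz (X k) (Num.max (B k i) 0)
                 * expgz (oplus 1 (X k)) (- B k i))%g]
    [ffun i => if i == k then (A k)^-1 * exchange_binomial s k else A i].

(* The n-regular tree: vertices are the words in the edge labels without equal
   adjacent letters, and an edge labeled k adds or removes a leading k. *)

Definition tree : Type := {w : seq 'I_n | sorted (fun i j => i != j) w}.

Definition tree_edge (k : 'I_n) (t t' : tree) : bool :=
  (val t' == k :: val t) || (val t == k :: val t').

Definition seed_pattern (Sigma : tree -> seed_data) : Prop :=
  (forall t, is_seed (Sigma t)) /\
  (forall k t t', tree_edge k t t' -> Sigma t' = mutate k (Sigma t)).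

Definition cluster_var (Sigma : tree -> seed_data) (t : tree) (k : 'I_n) : F :=
  seedA (Sigma t) k.

End Seeds.

Section FPolynomial.
Variables (K : idomainType) (n : nat) (F : ambientField K (trop n)).

Definition principal_coefficients
    (Sigma : tree n -> seed_data F n) (t0 : tree n) : Prop :=
  forall i, seedX (Sigma t0) i = trop_gen i.

(* The embedding of K[Z_1, ..., Z_n] in the ambient field. *)
Definition polyZ (f : {mpoly K[n]}) : F :=
  mmap (scal F) (fun i => coef F (trop_gen i)) f.

HB.instance Definition _ := GRing.RMorphism.copy polyZ
  (mmap (scal F) (fun i => coef F (trop_gen i))).

Definition mon (m : 'X_{1..n}) : trop n := [ffun i => (m i)%:Z].

Lemma polyZE (f : {mpoly K[n]}) :
  polyZ f = \sum_(m <- msupp f) scal F f@_m * coef F (mon m).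
Proof.
rewrite /polyZ /mmap; apply: eq_bigr => m _; congr (_ * _); rewrite /mmap1.
have coefX x k : coef F (x ^+ k)%g = coef F x ^+ k.
  by elim: k => [|k IHk]; rewrite ?expg0 ?coef1 // expgS exprS coefM IHk.
under eq_bigr => i _ do rewrite -coefX.
rewrite -(big_morph (coef F) (coefM F) (coef1 F)); congr (coef F _).
apply/ffunP => j; rewrite ffunE.
have expE (x : trop n) k : (x ^+ k)%g j = x j *+ k.
  by elim: k => [|k IHk]; rewrite ?ffunE // expgS ffunE IHk mulrS.
rewrite (big_morph (fun x : trop n => x j) (id1 := 0) (op1 := +%R)); first last.
- by rewrite ffunE.
- by move=> x y; rewrite ffunE.
rewrite (bigD1 j) //= expE ffunE eqxx big1 ?addr0 ?natz // => i /negPf neq_ij.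
by rewrite expE ffunE neq_ij mul0rn.
Qed.

Lemma polyZ_inj : injective polyZ.
Proof.
pose nom (x : trop n) : 'X_{1..n} := [multinom `|x i|%N | i < n].
have monK : cancel mon nom by move=> m; apply/mnmP => i; rewrite mnmE ffunE.
apply: raddf_inj => f /= f0; apply/mpolyP => m.
rewrite mcoeff0; have [mf|/memN_msupp_eq0//] := boolP (m \in msupp f).
rewrite -[m in LHS]monK.
apply: (coef_free (a := F) (s := map mon (msupp f)) (c := fun x => f@_(nom x))).
- by rewrite map_inj_uniq ?msupp_uniq //; apply: can_inj monK.
- by rewrite -[RHS]f0 [RHS]polyZE big_map; apply: eq_bigr => i _; rewrite monK.
- exact: map_f.
Qed.

Lemma polyZ_in_KP (f : {mpoly K[n]}) : in_KP (polyZ f).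
Proof.
pose nom (x : trop n) : 'X_{1..n} := [multinom `|x i|%N | i < n].
have monK : cancel mon nom by move=> m; apply/mnmP => i; rewrite mnmE ffunE.
exists (map mon (msupp f)), (fun x => f@_(nom x)).
by rewrite [RHS]big_map polyZE; apply: eq_bigr => m _; rewrite monK.
Qed.

(* a is the Laurent polynomial p / 'X_[m] in A, with p over K[Z_1, ..., Z_n],
   and f is its value at A_1 = ... = A_n = 1. *)
Definition value_at_one (A : 'I_n -> F) (a : F) (f : {mpoly K[n]}) : Prop :=
  exists (p : {mpoly {mpoly K[n]}[n]}) (m : 'X_{1..n}),
    a * \prod_(i < n) A i ^+ m i = mmap polyZ A p /\ f = p.@[fun=> 1].

Lemma value_at_one_inj (A : 'I_n -> F) (a : F) (f g : {mpoly K[n]}) :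
  free_generating A -> value_at_one A a f -> value_at_one A a g -> f = g.
Proof.
move=> [A_free _] [p [m [Ep ->]]] [q [m' [Eq ->]]].
suff /(congr1 (meval (fun=> 1))) : p * 'X_[m'] = q * 'X_[m].
  rewrite !mevalM !mevalX !big1 ?mulr1 // => i _; exact: expr1n.
apply/eqP; rewrite -subr_eq0; apply/eqP; set r := p * _ - _.
have r0 : mmap polyZ A r = 0.
  by rewrite rmorphB !rmorphM /= -Ep -Eq !mmapX /mmap1 mulrAC subrr.
suff r0' : map_mpoly polyZ r = 0.
  apply/mpolyP => k; apply: polyZ_inj.
  by rewrite -mcoeff_map_mpoly r0' !mcoeff0 rmorph0.
apply: A_free => [k|]; first by rewrite mcoeff_map_mpoly; exact: polyZ_in_KP.
rewrite -r0 /meval /mmap (perm_big _ (msupp_map_mpoly _ polyZ_inj)) /=.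
by apply: eq_bigr => k _; rewrite mcoeff_map_mpoly.
Qed.

(* By the Laurent phenomenon the value exists; it is unique by
   [value_at_one_inj]. *)
Definition F_polynomial (Sigma : tree n -> seed_data F n) (t0 t : tree n)
    (k : 'I_n) : {mpoly K[n]} :=
  epsilon (inhabits 0)
    (value_at_one (seedA (Sigma t0)) (cluster_var Sigma t k)).

End FPolynomial.

(* Main.v *)
Require Import Defs.
From HB Require Import structures.
From mathcomp Require Import all_boot all_order all_algebra.
From mathcomp Require Import mpoly.
From mathcomp Require Import zify ring.
From Stdlib Require Import ClassicalEpsilon.

Set Implicit Arguments.
Unset Strict Implicit.
Unset Printing Implicit Defensive.

Import Order.TTheory GRing.Theory Num.Theory.
Local Open Scope ring_scope.

(** The F-polynomial F of a cluster variable a is irreducible because a itself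
    is irreducible in the upper cluster algebra, and because each factor of F
    can be turned into an element of the upper cluster algebra.

    Everything happens inside the ambient field. A Laurent ring is the set of
    combinations of the monomials x^u of one cluster, studied through the
    gradings of the exponent lattice. The gradings show that
    factors of homogeneous elements are homogeneous (homog_factor), that the
    binomials 1 + x^u are prime when some coordinate of u is 1
    (binomial_prime), and that 1 + x^u and 1 + x^v are coprime when u and v are
    independent (lcoprime_binomial).

    With principal coefficients the extended exchange matrix has full rank,
    and mutation preserves the rank. Its columns are then independent, so the
    exchange polynomials of a seed are pairwise coprime. This makes the
    intersection of the Laurent rings of a seed and of its neighbours
    invariant under mutation (square_laurent, upper_invariant), which gives
    the Laurent phenomenon over K and over the integers, and shows that the
    intersection is the upper cluster algebra.

    The exchange relations preserve the shape a = A^g F(y), where A is the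
    initial cluster and y_i = Z_i \prod_j A_j^b_ji (cluster_var_separated).
    Here F is integral, and positive at the points where one Z_j is 0 and the
    others are 1: exchange relations are subtraction-free and one of their two
    terms does not involve Z_j. Hence no Z_j divides F.

    Let F = f h. At the initial seed the exchange polynomial in direction i is
    a unit times 1 + y_i, hence prime in the Laurent ring of the i-th
    neighbour, where it is associated with A_i. Dividing f(y) and h(y) by the
    largest possible power of each A_i yields p1 and p2 in the upper cluster
    algebra, divisible by no A_i. Since a is not divisible by A_i either
    (not_dvd_initial) and 1 + y_i is prime, the powers cancel and a = p1 p2.
    In the Laurent ring of a cluster containing a both factors are monomials,
    whose exponents are nonnegative because they lie in the upper cluster
    algebra; so one of them is a unit times a monomial in the Z_j
    (cluster_var_factor). The corresponding factor of F is then a unit times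
    a monomial in the Z_j, and as no Z_j divides F it is a unit. *)

(** * Spans of monomials in a field *)

Section Span.
Variables (k : nzRingType) (F : fieldType) (sc : {rmorphism k -> F}).
Variables (G : zmodType) (x : G -> F).
Implicit Types (C D : pred G) (p q : F).

(** Representations with repeated exponents are allowed, so that sums and
    products of spans need no normalization. *)
Definition span C p : Prop :=
  exists2 s : seq (k * G), all (fun a => C a.2) s &
    p = \sum_(a <- s) sc a.1 * x a.2.

Definition laurent p : Prop := span xpredT p.

Definition lfree : Prop := forall (s : seq G) (c : G -> k), uniq s ->
  \sum_(u <- s) sc (c u) * x u = 0 -> {in s, forall u, c u = 0}.

Definition monomial_map : Prop :=
  x 0 = 1 /\ {morph x : u v / u + v >-> u * v}.

Lemma span0 C : span C 0.
Proof. by exists [::]; rewrite ?big_nil. Qed.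

Lemma span_term C c u : C u -> span C (sc c * x u).
Proof. by move=> Cu; exists [:: (c, u)]; rewrite /= ?Cu // big_seq1. Qed.

Lemma span_mono C u : C u -> span C (x u).
Proof. by move=> Cu; rewrite -[x u]mul1r -(rmorph1 sc); apply: span_term. Qed.

Lemma spanD C p q : span C p -> span C q -> span C (p + q).
Proof.
move=> [s Cs ->] [s' Cs' ->]; exists (s ++ s'); first by rewrite all_cat Cs.
by rewrite big_cat.
Qed.

Lemma span_ind C (P : F -> Prop) : P 0 -> (forall c u, C u -> P (sc c * x u)) ->
  (forall p q, P p -> P q -> P (p + q)) -> forall p, span C p -> P p.
Proof.
move=> P0 P1 PD p [s /allP Cs ->]; rewrite big_seq; apply: big_ind => // a as_.
exact/P1/Cs.
Qed.

Lemma span_imp C D p : (forall u, C u -> D u) -> span C p -> span D p.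
Proof. by move=> CD [s Cs ->]; exists s => //; apply: sub_all Cs => a /CD. Qed.

Lemma spanN C p : span C p -> span C (- p).
Proof.
move: p; apply: span_ind => [|c u Cu|p q Cp Cq]; first by rewrite oppr0; exact: span0.
  by rewrite -mulNr -rmorphN; apply: span_term.
by rewrite opprD; apply: spanD.
Qed.

Lemma spanB C p q : span C p -> span C q -> span C (p - q).
Proof. by move=> Cp /spanN; apply: spanD. Qed.

Lemma span_split C D p : span C p ->
  exists p1 p2, [/\ p = p1 + p2, span (fun u => C u && D u) p1 &
                    span (fun u => C u && ~~ D u) p2].
Proof.
move: p; apply: span_ind => [|c u Cu|p q [p1 [p2 [-> ? ?]]] [q1 [q2 [-> ? ?]]]].
- by exists 0, 0; rewrite addr0; split=> //; apply: span0.
- case Du: (D u).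
    exists (sc c * x u), 0; rewrite addr0; split=> //; last exact: span0.
    by apply: span_term; rewrite /= Cu Du.
  exists 0, (sc c * x u); rewrite add0r; split=> //; first exact: span0.
  by apply: span_term; rewrite /= Cu Du.
- by exists (p1 + q1), (p2 + q2); split; [ring | apply: spanD..].
Qed.

Lemma span_normal C p : span C p ->
  exists (s : seq G) (c : G -> k), [/\ uniq s, all C s,
    (forall u, u \notin s -> c u = 0) & p = \sum_(u <- s) sc (c u) * x u].
Proof.
move=> [s Cs ->]; exists (undup (map snd s)).
exists (fun u => \sum_(a <- s | a.2 == u) a.1); split; first exact: undup_uniq.
- apply/allP => u; rewrite mem_undup => /mapP[a as_ ->]; exact: (allP Cs).
- move=> u; rewrite mem_undup => us; rewrite big_seq_cond big1 // => a.
  by case/andP=> as_ /eqP au; rewrite -au map_f in us.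
rewrite (eq_bigr (fun u => \sum_(a <- s) if a.2 == u then sc a.1 * x u else 0));
  last by move=> u _; rewrite /= rmorph_sum big_distrl -big_mkcond.
rewrite exchange_big /= big_seq [RHS]big_seq; apply: eq_bigr => a as_.
rewrite (bigD1_seq a.2) /= ?undup_uniq ?eqxx //; last first.
  by rewrite mem_undup map_f.
by rewrite big1 ?addr0 // => u; rewrite eq_sym => /negPf ->.
Qed.

Section Free.
Hypothesis x_free : lfree.

(** Linear independence, in the form that replaces the comparison of
    coefficients in all arguments by degree. *)
Lemma span_disjoint C D p : (forall u, C u -> ~~ D u) ->
  span C p -> span D p -> p = 0.
Proof.
move=> CD /span_normal[s [c [us Cs cs ps]]] /span_normal[s' [c' [us' Ds' cs' ps']]].
have dis u : u \in s -> u \notin s'.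
  by move=> /(allP Cs)/CD; apply: contra => /(allP Ds').
have E : \sum_(u <- s ++ s') sc (c u - c' u) * x u = 0.
  rewrite big_cat /= (_ : \sum_(u <- s) _ = p); last first.
    rewrite ps big_seq [RHS]big_seq; apply: eq_bigr => u /dis/cs' ->.
    by rewrite subr0.
  rewrite (_ : \sum_(u <- s') _ = - p) ?subrr //.
  rewrite ps' -sumrN big_seq [RHS]big_seq; apply: eq_bigr => u us'u.
  rewrite (cs u) ?sub0r ?rmorphN ?mulNr //.
  by apply/negP => /dis; rewrite us'u.
have Us : uniq (s ++ s').
  rewrite cat_uniq us us' andbT /=; apply/hasPn => u us'u.
  by apply/negP => /dis; rewrite us'u.
rewrite ps big_seq big1 // => u us_u.
have -> : c u = 0; last by rewrite rmorph0 mul0r.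
have /= := x_free Us E (x := u); rewrite (cs' _ (dis _ us_u)) subr0; apply.
by rewrite mem_cat us_u.
Qed.

Lemma span_conj C D p : span C p -> span D p -> span (fun u => C u && D u) p.
Proof.
move=> Cp Dp; have [p1 [p2 [ep Cp1 Cp2]]] := span_split D Cp.
have Dp1 : span D p1 by apply: span_imp Cp1 => u /andP[].
have : p2 = 0.
  apply: (@span_disjoint (fun u => ~~ D u) D) => //.
    by apply: span_imp Cp2 => u /andP[].
  by rewrite (_ : p2 = p - p1); [apply: spanB | rewrite ep addrC addKr].
by move=> p20; rewrite ep p20 addr0.
Qed.

Lemma span_forall (I : finType) (C : I -> pred G) p : laurent p ->
  (forall i, span (C i) p) -> span (fun u => [forall i, C i u]) p.
Proof.
move=> lp Cp.
suff H (r : seq I) : span (fun u => all (C^~ u) r) p.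
  apply: span_imp (H (enum I)) => u /allP Hu; apply/forallP => i.
  by apply: Hu; rewrite mem_enum.
elim: r => [|i r IH]; first exact: lp.
by apply: span_imp (span_conj (Cp i) IH).
Qed.

Lemma span_split_eq C D p1 p2 q1 q2 : (forall u, C u -> ~~ D u) ->
  span C p1 -> span D p2 -> span C q1 -> span D q2 ->
  p1 + p2 = q1 + q2 -> p1 = q1 /\ p2 = q2.
Proof.
move=> CD Cp1 Dp2 Cq1 Dq2 E.
have E' : p1 - q1 = q2 - p2.
  by apply/eqP; rewrite subr_eq addrAC -subr_eq opprK E addrC.
have Z : p1 - q1 = 0.
  apply: (span_disjoint CD); first exact: spanB.
  by rewrite E'; apply: spanB.
split; first exact: subr0_eq Z.
by move: E'; rewrite Z => /esym/subr0_eq ->.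
Qed.

End Free.

Section Mult.
Hypothesis xM : monomial_map.

Lemma mono0 : x 0 = 1. Proof. by case: xM. Qed.
Lemma monoD u v : x (u + v) = x u * x v. Proof. by case: xM. Qed.

Lemma mono_neq0 u : x u != 0.
Proof.
apply/eqP => xu0; have := mono0; rewrite -(subrr u) monoD xu0 mul0r => /esym/eqP.
by rewrite oner_eq0.
Qed.

Lemma monoN u : x (- u) = (x u)^-1.
Proof.
by apply: (mulIf (mono_neq0 u)); rewrite -monoD addNr mono0 mulVf ?mono_neq0.
Qed.

Lemma monoMn u m : x (u *+ m) = x u ^+ m.
Proof. by elim: m => [|m IH]; rewrite ?mono0 // mulrS monoD IH exprS. Qed.

Lemma spanM C1 C2 C p q : (forall u v, C1 u -> C2 v -> C (u + v)) ->
  span C1 p -> span C2 q -> span C (p * q).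
Proof.
move=> CC Cp Cq; elim/span_ind: Cp => [|c u Cu|p1 p2 H1 H2].
- by rewrite mul0r; apply: span0.
- elim/span_ind: Cq => [|d v Cv|q1 q2 H1 H2].
  + by rewrite mulr0; apply: span0.
  + rewrite mulrACA -rmorphM -monoD; exact/span_term/CC.
  + by rewrite mulrDr; apply: spanD.
- by rewrite mulrDl; apply: spanD.
Qed.

Lemma lau_mono u : laurent (x u). Proof. exact: span_mono. Qed.
Lemma lau_term c u : laurent (sc c * x u). Proof. exact: span_term. Qed.
Lemma lau1 : laurent 1. Proof. by rewrite -mono0; apply: lau_mono. Qed.
Lemma lauD p q : laurent p -> laurent q -> laurent (p + q). Proof. exact: spanD. Qed.
Lemma lauB p q : laurent p -> laurent q -> laurent (p - q). Proof. exact: spanB. Qed.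
Lemma lauM p q : laurent p -> laurent q -> laurent (p * q). Proof. exact: spanM. Qed.
Lemma lauX p m : laurent p -> laurent (p ^+ m).
Proof.
by move=> lp; elim: m => [|m IH]; [exact: lau1 | rewrite exprS; apply: lauM].
Qed.
Lemma span_lau C p : span C p -> laurent p. Proof. exact: span_imp. Qed.
Lemma lau_sc c : laurent (sc c).
Proof. by rewrite -[sc c]mulr1 -mono0; apply: lau_term. Qed.

(** ** Gradings of the Laurent ring *)

Section Grading.
Hypothesis x_free : lfree.
Variable (lam : G -> int).
Hypothesis lamD : {morph lam : u v / u + v >-> u + v}.

Lemma lam0 : lam 0 = 0.
Proof. by have := lamD 0 0; rewrite addr0; lia. Qed.

Lemma lamN u : lam (- u) = - lam u.
Proof. by have := lamD u (- u); rewrite subrr lam0; lia. Qed.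

Lemma lamMn u m : lam (u *+ m) = lam u *+ m.
Proof. by elim: m => [|m IH]; rewrite ?lam0 // !mulrS lamD IH. Qed.

Definition degeq (d : int) : pred G := fun u => lam u == d.
Definition deggt (d : int) : pred G := fun u => d < lam u.
Definition degge (d : int) : pred G := fun u => d <= lam u.

Lemma span_bounded p : laurent p ->
  exists a : int, exists m : nat, span (fun u => (a <= lam u) && (lam u < a + m%:Z)) p.
Proof.
move: p; apply: span_ind => [|c u _|p q [a [m Cp]] [b [l Cq]]].
- by exists 0, 0%N; apply: span0.
- by exists (lam u), 1%N; apply: span_term; lia.
- exists (Num.min a b), (absz (Num.max (a + m%:Z) (b + l%:Z) - Num.min a b)%R).
  by apply: spanD; [apply: span_imp Cp | apply: span_imp Cq] => u; lia.
Qed.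

(** Lowest homogeneous components exist because the degrees of a Laurent
    polynomial are bounded. *)
Lemma span_low p : laurent p -> p != 0 ->
  exists d pd, [/\ pd != 0, span (degeq d) pd & span (deggt d) (p - pd)].
Proof.
move=> /span_bounded[a [m]]; elim: m a p => [|m IH] a p Cp p0.
  case/eqP: p0; apply: (span_disjoint x_free _ Cp Cp) => u; lia.
have [p1 [p2 [ep Cp1 Cp2]]] := span_split (degeq a) Cp.
have Cp1' : span (degeq a) p1 by apply: span_imp Cp1 => u /andP[].
have Cp2' : span (fun u => (a + 1 <= lam u) && (lam u < a + 1 + m%:Z)) p2.
  by apply: span_imp Cp2 => u; rewrite /degeq /=; lia.
have [p10|p10] := eqVneq p1 0.
  by apply: (IH (a + 1)) => //; rewrite ep p10 add0r.
exists a, p1; split=> //; rewrite ep addrC addKr.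
by apply: span_imp Cp2' => u; rewrite /deggt; lia.
Qed.

End Grading.
End Mult.
End Span.

(** * Divisibility in Laurent rings *)

Section Divisibility.
Variables (k : nzRingType) (F : fieldType) (sc : {rmorphism k -> F}).
Variables (G : zmodType) (x : G -> F).
Hypotheses (x_free : lfree sc x) (xM : monomial_map x).
Implicit Types (C D : pred G) (p q f g h : F).

Notation span := (span sc x).
Notation laurent := (laurent sc x).

Lemma mono_inj (c d : k) u v : c != 0 -> sc c * x u = sc d * x v -> u = v /\ c = d.
Proof.
move=> c0 E; have [uv|uv] := eqVneq u v.
  split=> //; apply/eqP; rewrite -subr_eq0; apply/eqP.
  apply: (x_free (s := [:: u]) (c := fun _ => c - d) _ _ (mem_head u _)) => //.
  by rewrite big_seq1 rmorphB mulrBl E uv subrr.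
case/eqP: c0; pose cc w := if w == u then c else - d.
have <- : cc u = c by rewrite /cc eqxx.
apply: (x_free (s := [:: u; v])); last exact: mem_head.
  by rewrite /= inE uv.
by rewrite big_cons big_seq1 /cc eqxx eq_sym (negPf uv) rmorphN mulNr E subrr.
Qed.

Lemma sc_inj (c : k) : sc c = 0 -> c = 0.
Proof.
move=> c0; apply/eqP; apply: contraT => nz.
have E : sc c * x 0 = sc 0 * x 0 by rewrite c0 rmorph0.
by have [_ /eqP] := mono_inj nz E; rewrite (negPf nz).
Qed.

Lemma span_pred1 m p : span (pred1 m) p -> exists c, p = sc c * x m.
Proof.
move: p; apply: span_ind => [|c u /eqP -> |p q [c ->] [d ->]].
- by exists 0; rewrite rmorph0 mul0r.
- by exists c.
- by exists (c + d); rewrite rmorphD mulrDl.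
Qed.

Lemma binomial_neq0 u : u != 0 -> 1 + x u != 0.
Proof.
move=> u0; apply/negP => /eqP E.
have : x 0 = sc (- 1) * x u.
  by rewrite (mono0 xM) rmorphN rmorph1 mulN1r; apply/eqP; rewrite -addr_eq0 E.
rewrite -[x 0]mul1r -(rmorph1 sc) => /mono_inj[|Eu _]; first exact: oner_neq0.
by rewrite -Eu eqxx in u0.
Qed.

Lemma lau_binomial u : laurent (1 + x u).
Proof. by apply: lauD; [exact: lau1 | exact: lau_mono]. Qed.

Section OneGrading.
Variable (lam : G -> int).
Hypothesis lamD : {morph lam : u v / u + v >-> u + v}.

Lemma homog_low c p q : laurent p -> laurent q -> p * q != 0 ->
  span (degeq lam c) (p * q) ->
  exists d e, [/\ d + e = c, span (degge lam d) p & span (degge lam e) q].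
Proof.
move=> lp lq; rewrite mulf_eq0 negb_or => /andP[p0 q0] Cpq.
have [d [pd [pd0 Cpd Cp]]] := span_low x_free lam lp p0.
have [e [qe [qe0 Cqe Cq]]] := span_low x_free lam lq q0.
have Dp : span (degge lam d) p.
  rewrite -(subrK pd p); apply: spanD; [apply: span_imp Cp | apply: span_imp Cpd];
    by move=> u; rewrite /degge /deggt /degeq; lia.
have Dq : span (degge lam e) q.
  rewrite -(subrK qe q); apply: spanD; [apply: span_imp Cq | apply: span_imp Cqe];
    by move=> u; rewrite /degge /deggt /degeq; lia.
exists d, e; split=> //.
have Ce : span (degeq lam (d + e)) (pd * qe).
  by apply: (spanM xM) Cpd Cqe => u v; rewrite /degeq lamD; lia.
have Cr : span (deggt lam (d + e)) (p * q - pd * qe).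
  rewrite (_ : _ - _ = (p - pd) * q + pd * (q - qe)); last by ring.
  apply: spanD; [apply: (spanM xM) Cp Dq | apply: (spanM xM) Cpd Cq];
    by move=> u v; rewrite /degge /deggt /degeq lamD; lia.
case: (ltgtP (d + e) c) => // H; exfalso.
- have : pd * qe = 0.
    apply: (@span_disjoint _ _ _ _ _ x_free (degeq lam (d + e)) (deggt lam (d + e))) => //.
      by move=> u; rewrite /degeq /deggt; lia.
    rewrite -[pd * qe](subKr (p * q)); apply: spanB; last exact: Cr.
    by apply: span_imp Cpq => u; rewrite /degeq /deggt; lia.
  by move/eqP; rewrite mulf_eq0 (negPf pd0) (negPf qe0).
- have : p * q = 0.
    apply: (@span_disjoint _ _ _ _ _ x_free (degeq lam c) (degge lam (d + e))) => //.
      by move=> u; rewrite /degeq /degge; lia.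
    by apply: (spanM xM) Dp Dq => u v; rewrite /degge lamD; lia.
  by move/eqP; rewrite mulf_eq0 (negPf p0) (negPf q0).
Qed.

End OneGrading.

Section Grading.
Variable (lam : G -> int).
Hypothesis lamD : {morph lam : u v / u + v >-> u + v}.

(** Lowest and highest degrees are both additive, so neither factor can have
    two distinct degrees. *)
Lemma homog_factor c p q : laurent p -> laurent q -> p * q != 0 ->
  span (degeq lam c) (p * q) -> exists d, span (degeq lam d) p.
Proof.
move=> lp lq pq0 Cpq.
have [d [e [dec Dp Dq]]] := homog_low lamD lp lq pq0 Cpq.
have nlamD : {morph (fun u => - lam u) : u v / u + v >-> u + v}.
  by move=> u v; rewrite lamD opprD.
have [|d' [e' [dec' Dp' Dq']]] := homog_low (c := - c) nlamD lp lq pq0.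
  by apply: span_imp Cpq => u; rewrite /degeq; lia.
move: pq0; rewrite mulf_eq0 negb_or => /andP[p0 q0].
have dd' : d <= - d'.
  rewrite leNgt; apply/negP => H; case/eqP: p0.
  apply: (span_disjoint x_free _ Dp Dp') => u; rewrite /degge; lia.
have ee' : e <= - e'.
  rewrite leNgt; apply/negP => H; case/eqP: q0.
  apply: (span_disjoint x_free _ Dq Dq') => u; rewrite /degge; lia.
exists d; apply: span_imp (span_conj x_free Dp Dp') => u.
rewrite /degge /degeq; lia.
Qed.

(** The binomial has two distinct degrees, so it has no homogeneous nonzero
    multiple. *)
Lemma binomial_homog0 u h : lam u != 0 -> laurent h ->
  span (degeq lam 0) ((1 + x u) * h) -> h = 0.
Proof.
move=> lu lh C0; apply/eqP/negP => /negP h0.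
have u0 : u != 0 by apply: contraNneq lu => ->; rewrite (lam0 lamD).
have [|d Cd] := homog_factor (lau_binomial u) lh _ C0.
  by rewrite mulf_neq0 // binomial_neq0.
have C1 : span (degeq lam 0) 1.
  by rewrite -(mono0 xM); apply: span_mono; rewrite /degeq (lam0 lamD).
have Cu : span (degeq lam (lam u)) (x u) by apply: span_mono; rewrite /degeq.
have [d0|d0] := eqVneq d 0.
  have : x u = 0.
    apply: (span_disjoint (C := degeq lam (lam u)) (D := degeq lam 0) x_free) => //.
      by move=> v; rewrite /degeq => /eqP ->.
    by rewrite -[x u](addKr 1) addrC; apply: spanB => //; rewrite -d0.
  by move/eqP; rewrite (negPf (mono_neq0 xM u)).
have : 1 = 0 :> F.
  apply: (span_disjoint (C := degeq lam 0) (D := fun v => lam v != 0) x_free) => //.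
    by move=> v; rewrite /degeq negbK.
  rewrite -[1](addrK (x u)); apply: spanB.
    by apply: span_imp Cd => v /eqP ->.
  by apply: span_mono.
by move/eqP; rewrite oner_eq0.
Qed.

(** Division degree by degree: the lowest component of f is r times the
    component of g in the same degree, and subtracting it raises the degree. *)
Lemma graded_dvd (r w f g : F) : span (degeq lam 0) r -> span (deggt lam 0) w ->
  laurent f -> laurent g -> (1 + w) * f = r * g ->
  exists2 h, laurent h & f = r * h.
Proof.
move=> Cr Cw lf; have [a [m Cf]] := span_bounded lam lf.
elim: m a f g Cf {lf} => [|m IH] a f g Cf lg E.
  exists 0; first exact: span0.
  by rewrite mulr0; apply: (span_disjoint x_free _ Cf Cf) => u; lia.
have [f0 [f1 [ef Cf0 Cf1]]] := span_split (degeq lam a) Cf.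
have [g0 [g1 [eg Cg0 Cg1]]] := span_split (degeq lam a) lg.
have f0E : f0 = r * g0.
  have [] // := @span_split_eq _ _ _ _ _ x_free (degeq lam a)
     (fun u => ~~ degeq lam a u) f0 (f1 + w * f) (r * g0) (r * g1).
  - by move=> u ->.
  - by apply: span_imp Cf0 => u /andP[].
  - apply: spanD; first by apply: span_imp Cf1 => u /andP[].
    by apply: (spanM xM) Cw Cf => u v; rewrite /deggt /degeq lamD; lia.
  - by apply: (spanM xM) Cr Cg0 => u v; rewrite /degeq lamD; lia.
  - by apply: (spanM xM) Cr Cg1 => u v; rewrite /degeq lamD; lia.
  - by rewrite -mulrDr -eg -E mulrDl mul1r {2}ef addrA.
have [|||h lh f1E] := IH (a + 1) f1 (g - (1 + w) * g0).
- by apply: span_imp Cf1 => u; rewrite /degeq; lia.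
- apply: lauB => //; apply: lauM (span_lau Cg0) => //.
  by apply: lauD (span_lau Cw); apply: lau1.
- by rewrite mulrBr -E ef f0E; ring.
exists (g0 + h); first exact: lauD (span_lau Cg0) lh.
by rewrite ef f0E {1}f1E mulrDr.
Qed.

Section Prime.
Variable u : G.
Hypothesis lamu : lam u = 1.

Lemma binomial_reduce p : laurent p ->
  exists p0 h, [/\ span (degeq lam 0) p0, laurent h & p = p0 + (1 + x u) * h].
Proof.
(* A power of x^u, of either sign, is congruent to plus or minus 1. *)
have powE t h0 (m : nat) : laurent h0 -> t = - 1 + (1 + x u) * h0 ->
    exists2 h, laurent h & t ^+ m = (-1) ^+ m + (1 + x u) * h.
  move=> lh0 et; have lt : laurent t.
    rewrite et; apply: lauD; first by apply: spanN; exact: lau1.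
    by apply: lauM lh0 => //; apply: lau_binomial.
  elim: m => [|m [h lh IH]].
    by exists 0; [exact: span0 | rewrite !expr0 mulr0 addr0].
  exists (h0 * (-1) ^+ m + t * h).
    apply: lauD; last exact: lauM.
    by apply: lauM => //; apply: lauX => //; apply: spanN; exact: lau1.
  by rewrite !exprS IH mulrDr {1}et; ring.
move: p; apply: span_ind => [|c w _|p q [p0 [h [Cp0 lh ->]]] [q0 [h' [Cq0 lh' ->]]]].
- by exists 0, 0; split; rewrite ?mulr0 ?addr0 //; apply: span0.
- have [t [m [h [lh tE lt wE]]]] : exists t m h,
      [/\ laurent h, t ^+ m = (-1) ^+ m + (1 + x u) * h,
       laurent t & exists2 v, lam v = 0 & x w = x v * t ^+ m].
    have [m' lw] : exists m : nat, lam w = m%:Z \/ lam w = - m%:Z.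
      by exists (absz (lam w)); lia.
    case: lw => lw.
      have [|h lh E] := @powE (x u) 1 m' (lau1 sc xM); first by ring.
      exists (x u), m', h; split=> //; first exact: lau_mono.
      exists (w - u *+ m'); first by rewrite lamD (lamN lamD) (lamMn lamD) lamu; lia.
      by rewrite -(monoMn xM) -(monoD xM) subrK.
    have [||h lh E] := @powE (x (- u)) (x (- u)) m'; first exact: lau_mono.
      by rewrite mulrDl -(monoD xM) subrr (mono0 xM); ring.
    exists (x (- u)), m', h; split=> //; first exact: lau_mono.
    exists (w + u *+ m'); first by rewrite lamD (lamMn lamD) lamu; lia.
    by rewrite -(monoMn xM) -(monoD xM) mulNrn addrK.
  case: wE => v lv wE.
  exists (sc (c * (-1) ^+ m) * x v), (sc c * x v * h); split.
  + by apply: span_term; apply/eqP.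
  + by apply: lauM lh => //; apply: lau_term.
  + by rewrite wE tE rmorphM rmorphXn rmorphN1; ring.
- exists (p0 + q0), (h + h'); split; [exact: spanD | exact: lauD | ring].
Qed.

(** Modulo 1 + x^u every Laurent polynomial reduces to degree 0, where
    binomial_homog0 allows no multiple of 1 + x^u: the quotient is a Laurent
    ring in one variable less, hence a domain. *)
Lemma binomial_prime p q h : laurent p -> laurent q -> laurent h ->
  p * q = (1 + x u) * h ->
  (exists2 h', laurent h' & p = (1 + x u) * h') \/
  (exists2 h', laurent h' & q = (1 + x u) * h').
Proof.
move=> /binomial_reduce[p0 [h1 [Cp0 lh1 ->]]].
move=> /binomial_reduce[q0 [h2 [Cq0 lh2 ->]]] lh E.
have l1 : laurent (1 + x u) := lau_binomial u.
have lp0 := span_lau Cp0; have lq0 := span_lau Cq0.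
have E0 : p0 * q0 = (1 + x u) * (h - h1 * q0 - p0 * h2 - (1 + x u) * h1 * h2).
  by rewrite !mulrBr -E; ring.
have : p0 * q0 = 0.
  rewrite E0 [X in _ * X](@binomial_homog0 u) ?mulr0 //; first by rewrite lamu.
    by repeat (apply: lauB || apply: lauM).
  by rewrite -E0; apply: (spanM xM) Cp0 Cq0 => v w; rewrite /degeq lamD; lia.
move/eqP; rewrite mulf_eq0 => /orP[] /eqP->.
  by left; exists h1; rewrite ?add0r.
by right; exists h2; rewrite ?add0r.
Qed.

End Prime.
End Grading.

(** ** Coprimality *)

(** Coprimality of a and b, phrased by denominators: a fraction that can be
    written both over a and over b is Laurent. *)
Definition lcoprime a b : Prop :=
  forall p, laurent (a * p) -> laurent (b * p) -> laurent p.

Lemma lcoprime_pow a b p (N M : nat) : lcoprime a b -> laurent a -> laurent b ->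
  laurent (a ^+ N * p) -> laurent (b ^+ M * p) -> laurent p.
Proof.
move=> ab la lb.
have step q : laurent (a * q) -> laurent (b ^+ M * q) -> laurent q.
  elim: M => [|m IH] laq lbq; first by rewrite expr0 mul1r in lbq.
  apply: IH => //; apply: ab; last by rewrite mulrA -exprS.
  by rewrite mulrCA; apply: lauM => //; apply: lauX.
elim: N p => [|N IH] p laq lbq; first by rewrite expr0 mul1r in laq.
apply: step => //; apply: IH; first by rewrite mulrA -exprSr.
by rewrite mulrCA; apply: lauM.
Qed.

(** The grading makes 1 + x^u homogeneous but not 1 + x^v, whose lowest term is
    1 after a change of sign, so that graded_dvd applies. *)
Lemma lcoprime_binomial (lam : G -> int) u v :
  {morph lam : u v / u + v >-> u + v} ->
  u != 0 -> lam u = 0 -> lam v != 0 -> lcoprime (1 + x u) (1 + x v).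
Proof.
move=> lamD u0 lu lv p l1 l2.
wlog lvp : lam lamD lu lv / 0 < lam v.
  move=> H; case: (ltgtP 0 (lam v)) => lv'; first exact: (H lam).
    apply: (H (fun u => - lam u)); try lia.
    by move=> a b; rewrite lamD opprD.
  by rewrite -lv' eqxx in lv.
have [|||h lh E] := graded_dvd (r := 1 + x u) (w := x v) lamD _ _ l1 l2.
- apply: spanD; last by apply: span_mono; apply/eqP.
  by rewrite -(mono0 xM); apply: span_mono; rewrite /degeq (lam0 lamD).
- exact: span_mono.
- by rewrite mulrCA.
by rewrite (mulfI (binomial_neq0 u0) E).
Qed.

End Divisibility.

(** Every coordinate of the exponent is a grading, and an element homogeneous
    for all of them is a monomial. *)
Lemma mono_factor (k : nzRingType) (F : fieldType) (sc : {rmorphism k -> F})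
    (T : finType) (x : {ffun T -> int} -> F) p q w :
  lfree sc x -> monomial_map x -> laurent sc x p -> laurent sc x q ->
  p * q = x w ->
  exists c d m, [/\ c * d = 1, p = sc c * x m & q = sc d * x (w - m)].
Proof.
move=> x_free xM.
have coorD (t : T) : {morph (fun u : {ffun T -> int} => u t) : u v / u + v}.
  by move=> u v; rewrite ffunE.
have mono p' q' : laurent sc x p' -> laurent sc x q' -> p' * q' = x w ->
    exists c m, p' = sc c * x m.
  move=> lp lq E.
  have [|m Cm] := @fin_all_exists _ _ (fun t d => span sc x (degeq (fun u : {ffun T -> int} => u t) d) p').
    move=> t; apply: (homog_factor x_free xM (coorD t) (c := w t) lp lq).
      by rewrite E (mono_neq0 xM).
    by rewrite E; apply: span_mono; apply/eqP.
  have [|c ->] := @span_pred1 _ _ sc _ x (finfun m) p'; last by exists c, (finfun m).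
  apply: span_imp (span_forall x_free lp Cm) => u /forallP Hu.
  by apply/eqP/ffunP => t; rewrite ffunE; apply/eqP/Hu.
move=> lp lq E; have [c [m ep]] := mono _ _ lp lq E.
have [|d [m' eq]] := mono _ _ lq lp; first by rewrite mulrC.
have [|mw cd] := @mono_inj _ _ sc _ x x_free 1 (c * d) w (m + m') (oner_neq0 _).
  by rewrite rmorph1 mul1r -E ep eq rmorphM (monoD xM); ring.
by exists c, d, m; split=> //; rewrite mw [m + m' - m]addrC addKr.
Qed.

(** * Adjacent clusters *)

Lemma span_transfer (k : nzRingType) (F : fieldType) (sc : {rmorphism k -> F})
    (G : zmodType) (x x' : G -> F) (C : pred G) p :
  (forall u, C u -> x u = x' u) -> span sc x C p -> span sc x' C p.
Proof.
move=> xx'; move: p; apply: span_ind => [|c u Cu|p q]; first exact: span0.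
  by rewrite xx' //; apply: span_term.
exact: spanD.
Qed.

(** Two monomial maps as in adjacent clusters: they agree on exponents without
    e, and their values at e multiply to the exchange polynomial P. *)

Section Adjacent.
Variables (k : nzRingType) (F : fieldType) (sc : {rmorphism k -> F}).
Variables (G : zmodType) (x x' : G -> F) (al : G -> int) (e : G) (P : F).
Hypotheses (xM : monomial_map x) (x'M : monomial_map x').
Hypothesis alD : {morph al : u v / u + v >-> u + v}.
Hypotheses (al_e : al e = 1) (xx' : forall u, al u = 0 -> x u = x' u).
Hypotheses (exch : x e * x' e = P) (P_free : span sc x (degeq al 0) P).

Lemma adj_mono u : 0 <= al u -> laurent sc x' (x u).
Proof.
move=> au; rewrite -(subrK (e *+ absz (al u)) u) (monoD xM) (monoMn xM).
apply: (lauM x'M).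
  rewrite xx'; first exact: lau_mono.
  by rewrite alD (lamN alD) (lamMn alD) al_e; lia.
apply: (lauX x'M); rewrite -[x e](mulfK (mono_neq0 x'M e)) exch.
rewrite -(monoN x'M); apply: (lauM x'M); last exact: lau_mono.
by apply: span_lau (span_transfer _ P_free) => u' /eqP; apply: xx'.
Qed.

Lemma adj_clear p : laurent sc x p -> exists N, laurent sc x' (x e ^+ N * p).
Proof.
have le : laurent sc x' (x e) by apply: adj_mono; rewrite al_e.
move: p; apply: span_ind => [|c u _|p q [N lN] [M lM]].
- by exists 0%N; rewrite mulr0; apply: span0.
- exists (absz (al u)); rewrite mulrCA -(monoMn xM) -(monoD xM).
  apply: (lauM x'M); first exact: lau_sc.
  by apply: adj_mono; rewrite alD (lamMn alD) al_e; lia.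
- exists (N + M)%N; rewrite mulrDr; apply: lauD.
    by rewrite addnC exprD -mulrA; apply: (lauM x'M) => //; apply: (lauX x'M).
  by rewrite exprD -mulrA; apply: (lauM x'M) => //; apply: (lauX x'M).
Qed.

(** The classical equality of the intersection of two adjacent Laurent rings
    with R[a, a'], where a and a' are the exchanged variables: the parts of p
    with negative powers of a and with positive powers of a' coincide, because
    their difference has both only negative and only nonnegative powers of a
    once powers of P are cleared. *)
Lemma adj_inter p : lfree sc x -> laurent sc x p -> laurent sc x' p ->
  exists p1 p2, [/\ p = p1 + p2, span sc x (degge al 0) p1 &
                    span sc x' (degge al 0) p2].
Proof.
move=> x_free /(span_split (degge al 0))[f1 [f2 [ef Cf1 Cf2]]].
move=> /(span_split (deggt al 0))[g2 [g1 [eg Cg2 Cg1]]].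
have P0 : P != 0 by rewrite -exch mulf_neq0 ?(mono_neq0 xM) ?(mono_neq0 x'M).
have Pn (m : nat) : span sc x (degeq al 0) (P ^+ m).
  elim: m => [|m IH]; last first.
    rewrite exprS; apply: (spanM xM) P_free IH => u v.
    by rewrite /degeq alD; lia.
  by rewrite expr0 -(mono0 xM); apply: span_mono; rewrite /degeq (lam0 alD).
have x'e : x' e = P * x (- e).
  by rewrite -exch (monoN xM) mulrAC divff ?mul1r // (mono_neq0 xM).
have [N CN] : exists N, span sc x (degge al 0) (P ^+ N * g1).
  have {Cg1} : span sc x' (fun u => al u <= 0) g1.
    by apply: span_imp Cg1 => u; rewrite /deggt /=; lia.
  move: g1 {eg}; apply: span_ind => [|c u au|p1 p2 [N CN] [M CM]].
  - by exists 0%N; rewrite mulr0; apply: span0.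
  - exists (absz (al u)); set m := absz _.
    rewrite (_ : _ * _ = sc c * x (u + e *+ m + e *+ m)).
      by apply: span_term; rewrite /degge !alD (lamMn alD) al_e /m; lia.
    rewrite -{1}(addrK (e *+ m) u) (monoD x'M) -xx'; last first.
      by rewrite alD (lamMn alD) al_e /m; lia.
    rewrite !(monoD xM) (monoN x'M) !(monoMn xM) (monoMn x'M) -exch exprMn.
    by field; rewrite expf_neq0 // (mono_neq0 x'M).
  - exists (N + M)%N; rewrite mulrDr exprD; apply: spanD.
      rewrite mulrAC [_ * P ^+ M]mulrC; apply: (spanM xM) (Pn M) CN => u v.
      by rewrite /degeq /degge alD; lia.
    rewrite -mulrA; apply: (spanM xM) (Pn N) CM => u v.
    by rewrite /degeq /degge alD; lia.
have Cg2' : span sc x (fun u => al u < 0) g2.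
  have : span sc x' (deggt al 0) g2 by apply: span_imp Cg2 => u /andP[].
  move: g2 {eg Cg2}; apply: span_ind => [|c u au|p1 p2]; [exact: span0| |exact: spanD].
  rewrite -(subrK (e *+ absz (al u)) u); set m := absz _.
  rewrite (monoD x'M) (monoMn x'M) -xx'; last first.
    by move: au; rewrite /deggt alD (lamN alD) (lamMn alD) al_e /m; lia.
  rewrite x'e exprMn -(monoMn xM).
  rewrite (_ : _ * _ = P ^+ m * (sc c * x (u - e *+ m + (- e) *+ m))); last first.
    by rewrite (monoD xM (u - _)); ring.
  apply: (spanM xM (C2 := fun u => al u < 0)) (Pn m) _ => [v w|].
    by rewrite /degeq alD; lia.
  apply: span_term; move: au.
  by rewrite /deggt !alD mulNrn !(lamN alD) !(lamMn alD) al_e /m; lia.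
exists f1, g2; split.
- suff : P ^+ N * (f1 - g1) = 0.
    move/eqP; rewrite mulf_eq0 expf_eq0 (negPf P0) andbF subr_eq0 => /eqP ->.
    by rewrite eg addrC.
  apply: (span_disjoint (C := degge al 0) (D := fun u => al u < 0) x_free).
  + by move=> u; rewrite /degge; lia.
  + rewrite mulrBr; apply: spanB => //.
    have Cf1' : span sc x (degge al 0) f1 by apply: span_imp Cf1 => u /andP[].
    apply: (spanM xM) (Pn N) Cf1' => u v; rewrite /degge /degeq alD; lia.
  + rewrite (_ : f1 - g1 = g2 - f2); last first.
      by apply/eqP; rewrite subr_eq addrAC -subr_eq opprK -ef eg.
    have C : span sc x (fun u => al u < 0) (g2 - f2).
      by apply: spanB => //; apply: span_imp Cf2 => u; rewrite /degge /=; lia.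
    apply: (spanM xM) (Pn N) C => u v; rewrite /degeq alD; lia.
- by apply: span_imp Cf1 => u /andP[].
- by apply: span_imp Cg2 => u; rewrite /deggt /degge /=; lia.
Qed.

End Adjacent.

(** * The square of two mutations *)

(** The clusters x, xj, xk and xjk stand for a seed, its mutations at j and at
    k, and the mutation at j of the one at k. The gradings al and be read the
    exponents in directions j and k, y and z are the columns j and k of the
    extended matrix at x, and y' is the column j after mutation at k. *)

Section Square.
Variables (k : nzRingType) (F : fieldType) (sc : {rmorphism k -> F}).
Variables (G : zmodType) (x xj xk xjk : G -> F) (al be : G -> int) (e f : G).
Variables (y z y' Ny Nz N' : G).
Hypotheses (xM : monomial_map x) (xjM : monomial_map xj).
Hypotheses (xkM : monomial_map xk) (xjkM : monomial_map xjk).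
Hypotheses (x_free : lfree sc x) (xjk_free : lfree sc xjk).
Hypotheses (alD : {morph al : u v / u + v >-> u + v}).
Hypotheses (beD : {morph be : u v / u + v >-> u + v}).
Hypotheses (al_e : al e = 1) (be_e : be e = 0) (al_f : al f = 0) (be_f : be f = 1).
Hypotheses (x_xj : forall u, al u = 0 -> x u = xj u).
Hypotheses (x_xk : forall u, be u = 0 -> x u = xk u).
Hypotheses (xk_xjk : forall u, al u = 0 -> xk u = xjk u).
Hypotheses (al_y : al y = 0) (be_z : be z = 0) (al_y' : al y' = 0).
Hypotheses (al_Ny : al Ny = 0) (be_Nz : be Nz = 0) (al_N' : al N' = 0).
Hypothesis al_Nz : al Nz = Num.max (- al z) 0.
Hypothesis sign : [\/ be y = 0 /\ al z = 0, 0 < be y /\ al z < 0 |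
                      be y < 0 /\ 0 < al z].
Hypothesis exch_j : x e * xj e = x Ny * (1 + x y).
Hypothesis exch_k : x f * xk f = x Nz * (1 + x z).
Hypothesis exch_jk : x e * xjk e = xk N' * (1 + xk y').
Hypothesis y'_neg : be y <= 0 -> xk y' = x y * (1 + x z) ^+ absz (be y).
Hypothesis y'_pos : 0 <= be y -> xk y' * (1 + x (- z)) ^+ absz (be y) = x y.
Hypotheses (y_neq0 : y != 0).
Hypothesis yz_indep : exists lam : G -> int,
  [/\ {morph lam : u v / u + v >-> u + v}, lam y = 0 & lam z != 0].

Local Notation L := (laurent sc xjk).
Local Notation Pk := (x Nz * (1 + x z)).

Let xk_e : x e = xk e. Proof. exact: x_xk. Qed.
Let xk_exch : xk e * xjk e = xk N' * (1 + xk y'). Proof. by rewrite -xk_e. Qed.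

Let x_xjk u : al u = 0 -> be u = 0 -> x u = xjk u.
Proof. by move=> au bu; rewrite x_xk // xk_xjk. Qed.

Let exch_free : span sc xk (degeq al 0) (xk N' * (1 + xk y')).
Proof.
rewrite mulrDr mulr1 -(monoD xkM); apply: spanD; apply: span_mono; rewrite /degeq.
  by rewrite al_N'.
by rewrite alD al_N' al_y'.
Qed.

Let L_mono u : be u = 0 -> 0 <= al u -> L (x u).
Proof.
move=> bu au; rewrite x_xk //.
exact: (adj_mono xkM xjkM alD al_e xk_xjk xk_exch exch_free).
Qed.

Let L_Pk : L Pk.
Proof.
rewrite mulrDr mulr1 -(monoD xM); apply: lauD; apply: L_mono => //.
- by rewrite al_Nz; lia.
- by rewrite beD be_Nz be_z.
- by rewrite alD al_Nz; lia.
Qed.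

(** Elements that become Laurent in the far corner once the exchange
    polynomial at k is inverted; they form a ring. *)
Let D (p : F) : Prop := exists M, L (Pk ^+ M * p).

Let DL p : L p -> D p. Proof. by exists 0%N; rewrite mul1r. Qed.

Let DM p q : D p -> D q -> D (p * q).
Proof.
move=> [M lM] [N lN]; exists (M + N)%N; rewrite exprD mulrACA.
exact: (lauM xjkM).
Qed.

Let DD p q : D p -> D q -> D (p + q).
Proof.
move=> [M lM] [N lN]; exists (M + N)%N; rewrite exprD mulrDr.
apply: lauD; last by rewrite -mulrA; apply: (lauM xjkM) => //; apply: (lauX xjkM).
by rewrite [_ ^+ M * _]mulrC -mulrA; apply: (lauM xjkM) => //; apply: (lauX xjkM).
Qed.

Let DX p m : D p -> D (p ^+ m).
Proof.
move=> Dp; elim: m => [|m IH]; last by rewrite exprS; apply: DM.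
by apply: DL; apply: lau1.
Qed.

Let D_mono u : 0 <= al u -> D (x u).
Proof.
move=> au; have bE : exists m : nat, be u = m%:Z \/ be u = - m%:Z.
  by exists (absz (be u)); lia.
case: bE => m [] bu.
  rewrite -(subrK (f *+ m) u) (monoD xM) (monoMn xM); apply: DM.
    apply/DL/L_mono; rewrite ?alD ?beD ?(lamN alD) ?(lamN beD) ?(lamMn alD) ?(lamMn beD);
    by rewrite ?al_f ?be_f; lia.
  apply: DX; apply: DL; rewrite -[x f](mulfK (mono_neq0 xkM f)) exch_k.
  rewrite -(monoN xkM) xk_xjk ?(lamN alD) ?al_f //.
  by apply: (lauM xjkM) => //; apply: lau_mono.
rewrite -(addrK (f *+ m) u) (monoD xM) -mulNrn (monoMn xM); apply: DM.
  apply/DL/L_mono; rewrite ?alD ?beD ?(lamMn alD) ?(lamMn beD);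
  by rewrite ?al_f ?be_f; lia.
apply: DX; exists 1%N; rewrite expr1 -exch_k (monoN xM) mulrAC.
by rewrite divff ?(mono_neq0 xM) // mul1r xk_xjk //; apply: lau_mono.
Qed.

Let pow1 t n : L t -> exists2 s, L s & (1 + t) ^+ n = 1 + t * s.
Proof.
move=> lt; elim: n => [|n [s ls IH]]; first by exists 0; [exact: span0 | rewrite mulr0 addr0].
exists (1 + (1 + t) * s); last by rewrite exprS IH; ring.
have l1 := lau1 sc xjkM.
by apply: lauD => //; apply: (lauM xjkM) => //; apply: lauD.
Qed.

(** Modulo the variable at j, the exchange polynomials in direction j before
    and after the mutation at k agree up to a unit, once the exchange
    polynomial at k is inverted. *)
Let D_exch : D (xj e).
Proof.
have e0 := mono_neq0 xM e.
have E1 : L ((1 + xk y') / x e).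
  rewrite (_ : _ / _ = xk (- N') * xjk e).
    rewrite xk_xjk ?(lamN alD) ?al_N' //; apply: (lauM xjkM); exact: lau_mono.
  apply: (mulIf e0); rewrite mulfVK // -mulrA [xjk e * _]mulrC exch_jk mulrA.
  by rewrite -(monoD xkM) addNr (mono0 xkM) mul1r.
suff : D ((1 + x y) / x e).
  move=> H; rewrite (_ : xj e = x Ny * ((1 + x y) / x e)).
    by apply: DM => //; apply: D_mono; rewrite al_Ny.
  by apply: (mulIf e0); rewrite -[RHS]mulrA mulfVK // -exch_j mulrC.
have quot t n : L t -> L (t / x e) -> L (((1 + t) ^+ n - 1) / x e).
  move=> lt lte; have [s ls ->] := pow1 n lt.
  by rewrite addrC addKr mulrAC; apply: (lauM xjkM).
have div_e u : x u / x e = x (u - e) by rewrite (monoD xM) (monoN xM).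
have [by0|by0] := leP (be y) 0.
- have := y'_neg by0; move E : (absz _) => n yE.
  rewrite (_ : _ / _ = (1 + xk y') / x e +
                       (- x y) * (((1 + x z) ^+ n - 1) / x e)); last first.
    by rewrite yE; field.
  apply: DD; first exact: DL.
  apply: DM.
    by rewrite -mulN1r; apply: DM; [apply/DL/spanN/lau1 | apply: D_mono; rewrite al_y].
  case: n E {yE} => [|n] E.
    by rewrite expr0 subrr mul0r; apply/DL/span0.
  have az : 0 < al z by case: sign; lia.
  apply/DL/quot; first by apply: L_mono => //; lia.
  rewrite div_e; apply: L_mono; rewrite ?alD ?beD ?(lamN alD) ?(lamN beD); lia.
- have := y'_pos (ltW by0); move E : (absz _) => n yE.
  have az : al z < 0 by case: sign; lia.
  have lz : L (x (- z)) by apply: L_mono; rewrite ?(lamN alD) ?(lamN beD); lia.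
  rewrite (_ : _ / _ = (1 + x (- z)) ^+ n * ((1 + xk y') / x e) +
                       (- 1) * (((1 + x (- z)) ^+ n - 1) / x e)); last first.
    by rewrite -yE; field.
  have l1 := lau1 sc xjkM.
  apply/DL/lauD; apply: (lauM xjkM) => //; [|exact: spanN|].
    by apply: (lauX xjkM); apply: lauD.
  apply: quot => //.
  rewrite div_e; apply: L_mono; rewrite ?alD ?beD ?(lamN alD) ?(lamN beD); lia.
Qed.

Let D_inter p : laurent sc x p -> laurent sc xj p -> D p.
Proof.
move=> lx lxj.
have exch_free' : span sc x (degeq al 0) (x Ny * (1 + x y)).
  rewrite mulrDr mulr1 -(monoD xM); apply: spanD; apply: span_mono; rewrite /degeq.
    by rewrite al_Ny.
  by rewrite alD al_Ny al_y.
have [p1 [p2 [-> C1 C2]]] :=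
  adj_inter xM xjM alD al_e x_xj exch_j exch_free' x_free lx lxj.
have Dsc c : D (sc c) by apply/DL/lau_sc.
apply: DD.
  move: p1 C1; apply: span_ind => [|c u au|q q']; [exact/DL/span0| |exact: DD].
  by apply: DM => //; apply: D_mono.
move: p2 C2; apply: span_ind => [|c u au|q q']; [exact/DL/span0| |exact: DD].
apply: DM => //; rewrite -(subrK (e *+ absz (al u)) u) (monoD xjM) (monoMn xjM).
have a0 : al (u - e *+ absz (al u)) = 0.
  by move: au; rewrite /degge alD (lamN alD) (lamMn alD) al_e; lia.
by rewrite -x_xj //; apply: DM; [apply: D_mono; rewrite a0 | apply/DX/D_exch].
Qed.

(** If the directions j and k interact, the exchange polynomial at k is a unit
    modulo the variable at j; otherwise both are, up to units, binomials with
    independent exponents. *)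
Let coprime_jk : lcoprime sc xjk (x e) Pk.
Proof.
move=> p; have [by0|by0] := eqVneq (be y) 0.
  have az : al z = 0 by case: sign; lia.
  have aN : al Nz = 0 by rewrite al_Nz az; lia.
  have yE : xjk y = xk y' by rewrite -x_xjk // y'_neg ?by0 // mulr1.
  have xeE : x e = xjk (N' - e) * (1 + xjk y).
    rewrite -[x e](mulfK (mono_neq0 xjkM e)) exch_jk yE xk_xjk // mulrAC.
    by rewrite -(monoN xjkM) -(monoD xjkM).
  have [lam [lamD ly lz]] := yz_indep.
  move=> l1 l2; apply: (lcoprime_binomial xjk_free xjkM lamD y_neq0 ly lz).
    rewrite (_ : _ * p = xjk (e - N') * (x e * p)).
      by apply: (lauM xjkM) => //; apply: lau_mono.
    by rewrite xeE !mulrA -(monoD xjkM) addrA subrK subrr (mono0 xjkM) mul1r.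
  rewrite (_ : _ * p = xjk (- Nz) * (Pk * p)).
    by apply: (lauM xjkM) => //; apply: lau_mono.
  rewrite (x_xjk aN be_Nz) (x_xjk az be_z) !mulrA -(monoD xjkM) addNr.
  by rewrite (mono0 xjkM) mul1r.
have [u0 [u1 [PkE [a0 b0] [a1 b1]]]] : exists u0 u1,
    [/\ Pk = x u0 + x u1, al u0 = 0 /\ be u0 = 0 & 0 < al u1 /\ be u1 = 0].
  have PE : Pk = x Nz + x (Nz + z) by rewrite mulrDr mulr1 -(monoD xM).
  have bNz : be (Nz + z) = 0 by rewrite beD be_Nz be_z.
  case: (ltgtP (al z) 0) sign => az; case=> [] [by1 az']; try lia.
    exists (Nz + z), Nz; rewrite PE addrC alD al_Nz; split=> //; split=> //; lia.
  exists Nz, (Nz + z); rewrite PE alD al_Nz; split=> //; split=> //; lia.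
move=> l1 l2.
rewrite (_ : p = xjk (- u0) * (Pk * p - x (u1 - e) * (x e * p))).
  apply: (lauM xjkM); first exact: lau_mono.
  apply: lauB => //; apply: (lauM xjkM) => //.
  by apply: L_mono; rewrite ?alD ?beD ?(lamN alD) ?(lamN beD); lia.
rewrite PkE mulrA -(monoD xM) subrK -mulrBl addrK (x_xjk a0 b0) mulrA -(monoD xjkM).
by rewrite addNr (mono0 xjkM) mul1r.
Qed.

(** Two coprime denominators are available for p in the far corner: powers of
    the exchange polynomial at k, by way of x and xj, and powers of the
    variable at j, by way of xk. *)
Lemma square_laurent p : laurent sc x p -> laurent sc xj p -> laurent sc xk p ->
  laurent sc xjk p.
Proof.
move=> lx lxj lxk; have [M lM] := D_inter lx lxj.
have [N lN] := adj_clear xkM xjkM alD al_e xk_xjk xk_exch exch_free lxk.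
apply: (lcoprime_pow xjkM coprime_jk _ L_Pk _ lM); last by rewrite xk_e; exact: lN.
by apply: L_mono => //; rewrite al_e.
Qed.

End Square.

(** * Cluster monomials and extended exchange matrices *)

Section Seeds.
Variables (K : idomainType) (n : nat) (F : ambientField K (trop n)).
Implicit Types (A : 'I_n -> F) (s : seed_data F n) (i j k : 'I_n).

(** Exponent vectors of Laurent monomials: the left summand indexes the
    coefficients Z_i and the right one the cluster. *)
Local Notation expo := {ffun 'I_n + 'I_n -> int}.
Implicit Types (u v : expo).

Definition cmono A u : F :=
  coef F ([ffun i => u (inl i)] : trop n) * \prod_i A i ^ u (inr i).

Definition pospart u : expo := [ffun t => Num.max (u t) 0].
Definition negpart u : expo := [ffun t => Num.max (- u t) 0].
Definition avar k : expo := [ffun t => (t == inr k)%:Z].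

(** A column of the extended exchange matrix: since coefficients are tropical,
    X_i is just the lower half of the column of B indexed by i. *)
Definition extcol s i : expo :=
  [ffun t => match t with inl j => (seedX s i : {ffun 'I_n -> int}) j
                        | inr j => seedB s j i end].

Lemma pospartE u : pospart u = u + negpart u.
Proof. by apply/ffunP => t; rewrite !ffunE; move: (u t) => a; lia. Qed.

Lemma coorD (t : 'I_n + 'I_n) : {morph (fun u : expo => u t) : u v / u + v}.
Proof. by move=> u v; rewrite ffunE. Qed.

Lemma cmono_map A : (forall i, A i != 0) -> monomial_map (cmono A).
Proof.
move=> A0; split.
  rewrite /cmono big1 ?mulr1 => [|i _]; last by rewrite ffunE expr0z.
  by rewrite -(Defs.coef1 F); congr (coef F _); apply/ffunP => i; rewrite !ffunE.
move=> u v; rewrite /cmono.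
rewrite (eq_bigr (fun i => A i ^ u (inr i) * A i ^ v (inr i))); last first.
  by move=> i _; rewrite ffunE expfzDr.
rewrite big_split mulrACA -Defs.coefM /=; congr (coef F _ * _).
by apply/ffunP => i; rewrite !ffunE.
Qed.

Lemma cmono_avar A k : cmono A (avar k) = A k.
Proof.
rewrite /cmono (bigD1 k) //= big1 ?mulr1 => [|i ik]; last first.
  by rewrite ffunE (inj_eq inr_inj) (negPf ik) expr0z.
rewrite [avar k (inr k)]ffunE eqxx expr1z (_ : finfun _ = 1%g :> trop n) ?Defs.coef1 ?mul1r //.
by apply/ffunP => i; rewrite !ffunE.
Qed.

Lemma free_neq0 A : free_generating A -> forall i, A i != 0.
Proof.
move=> [A_free _] i; apply/eqP => Ai0.
have /A_free : over_KP ('X_i : {mpoly F[n]}).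
  move=> m; rewrite mcoeffX; case: eqP => _.
    by exists [:: 1%g], (fun _ => 1); rewrite big_seq1 rmorph1 mul1r Defs.coef1.
  by exists [::], (fun _ => 1); rewrite big_nil.
rewrite mevalXU Ai0 => /(_ erefl)/(congr1 (mcoeff U_(i))).
by rewrite mcoeffX eqxx mcoeff0 => /eqP; rewrite oner_eq0.
Qed.

(** Multiplication by a large monomial turns a relation between Laurent
    monomials into one between monomials, to which freeness applies. *)
Lemma cmono_free A : free_generating A -> lfree (scal F) (cmono A).
Proof.
move=> Afg; have A0 := free_neq0 Afg; case: Afg => A_free _ s c us E.
pose M i : nat := (\sum_(u <- s) absz (u (inr i)))%N.
have leM u i : u \in s -> (absz (u (inr i)) <= M i)%N.
  by move=> us_u; rewrite /M (big_rem u) //= leq_addr.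
pose mexp u : 'X_{1..n} := [multinom absz (u (inr i) + (M i)%:Z)%R | i < n].
pose zp u : trop n := [ffun i => u (inl i)].
pose un (m : 'X_{1..n}) (z : trop n) : expo :=
  [ffun t => match t with inl i => z i | inr i => (m i)%:Z - (M i)%:Z end].
have unK u : u \in s -> un (mexp u) (zp u) = u.
  move=> us_u; apply/ffunP => -[] i; rewrite !ffunE //= mnmE.
  by move: (leM u i us_u); move: (u (inr i)) => a; lia.
pose p : {mpoly F[n]} := \sum_(u <- s) (scal F (c u) * coef F (zp u)) *: 'X_[mexp u].
have pE m : p@_m = \sum_(z <- map zp [seq u <- s | mexp u == m])
                     scal F (c (un m z)) * coef F z.
  rewrite big_map big_filter raddf_sum /= [RHS]big_mkcond /= big_seq [RHS]big_seq.
  apply: eq_bigr => u us_u; rewrite mcoeffZ mcoeffX.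
  by case: eqP => [<-|_]; rewrite ?mulr0 // mulr1 unK.
have p0 : p = 0.
  apply: A_free => [m|]; first by rewrite pE; eexists _, _.
  rewrite raddf_sum /=.
  transitivity ((\sum_(u <- s) scal F (c u) * cmono A u) * \prod_i A i ^ (M i)%:Z).
    rewrite mulr_suml big_seq [RHS]big_seq.
    apply: eq_bigr => u us_u; rewrite mevalZ mevalX /cmono -!mulrA -big_split /=.
    congr (_ * (_ * _)); apply: eq_bigr => i _; rewrite mnmE -expfzDr //.
    have : 0 <= u (inr i) + (M i)%:Z.
      by move: (leM u i us_u); move: (u (inr i)) => a; lia.
    by case: (_ + _).
  by rewrite E mul0r.
move=> u us_u; rewrite -(unK u us_u).
apply: (coef_free (a := F) (s := map zp [seq v <- s | mexp v == mexp u])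
          (c := fun z => c (un (mexp u) z))).
- rewrite map_inj_in_uniq ?filter_uniq // => v w.
  rewrite !mem_filter => /andP[/eqP ev sv] /andP[/eqP ew sw] vw.
  by rewrite -(unK v sv) -(unK w sw) vw ev ew.
- by rewrite -pE p0 mcoeff0.
- by apply: map_f; rewrite mem_filter eqxx.
Qed.

(** ** Mutation of extended columns *)

Lemma exchange_binomialE s k : exchange_binomial s k =
  cmono (seedA s) (pospart (extcol s k)) + cmono (seedA s) (negpart (extcol s k)).
Proof.
case: s => B X A; rewrite /exchange_binomial /cmono /=; congr (coef F _ * _ + coef F _ * _).
- by apply/ffunP => i; rewrite !ffunE /=; move: (X k i) => a; lia.
- rewrite big_mkcond; apply: eq_bigr => i _; rewrite !ffunE /=.
  by case: ltP => H; rewrite ?expr0z.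
- by apply/ffunP => i; rewrite !ffunE /=; move: (X k i) => a; lia.
- rewrite big_mkcond; apply: eq_bigr => i _; rewrite !ffunE /=.
  by case: ltP => H; [rewrite max_l //; lia | rewrite max_r ?expr0z //; lia].
Qed.

Lemma seedA_mutate s k i : seedA (mutate k s) i =
  if i == k then (seedA s k)^-1 * exchange_binomial s k else seedA s i.
Proof. by case: s => B X A; rewrite /= ffunE. Qed.

Lemma cmono_mutate s k u : u (inr k) = 0 ->
  cmono (seedA s) u = cmono (seedA (mutate k s)) u.
Proof.
move=> uk; congr (_ * _); apply: eq_bigr => i _; rewrite seedA_mutate.
by case: eqP => // ->; rewrite uk !expr0z.
Qed.

Lemma cmono_exchange s k : (forall i, seedA s i != 0) ->
  cmono (seedA s) (avar k) * cmono (seedA (mutate k s)) (avar k) =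
  cmono (seedA s) (negpart (extcol s k)) * (1 + cmono (seedA s) (extcol s k)).
Proof.
move=> A0; rewrite !cmono_avar seedA_mutate eqxx mulVKf // exchange_binomialE.
by rewrite pospartE (monoD (cmono_map A0)); ring.
Qed.

Lemma skew_sign s i j : is_seed s ->
  [\/ seedB s i j = 0 /\ seedB s j i = 0, 0 < seedB s i j /\ seedB s j i < 0 |
      seedB s i j < 0 /\ 0 < seedB s j i].
Proof.
case=> -[d d0 /matrixP/(_ j i)]; rewrite !mxE => E _.
move: E; rewrite (bigD1 i) //= big1 ?addr0 => [|l li]; last first.
  by rewrite mxE eq_sym (negPf li) mulr0n mul0r.
rewrite (bigD1 j) //= big1 ?addr0 => [|l lj]; last first.
  by rewrite mxE eq_sym (negPf lj) mulr0n mul0r.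
rewrite !mxE !eqxx !mulr1n; move: (d0 i) (d0 j).
move: (d 0 i) (d 0 j) (seedB s i j) (seedB s j i) => di dj a b di0 dj0 E.
case: (ltgtP a 0) E => [a0|a0|->] E; [constructor 3|constructor 2|constructor 1].
- by split=> //; nia.
- by split=> //; nia.
- by split=> //; nia.
Qed.

Lemma diag0 s k : is_seed s -> seedB s k k = 0.
Proof. by move=> /(skew_sign k k)[] []; lia. Qed.

Lemma extcol_mutate_self s k : extcol (mutate k s) k = - extcol s k.
Proof.
apply/ffunP => -[] i; case: s => B X A; rewrite !ffunE /=.
  by rewrite ?ffunE eqxx ?ffunE.
by rewrite mxE eqxx orbT.
Qed.

Lemma expgz_trop (z : trop n) (m : int) i : (expgz z m : trop n) i = z i * m.
Proof.
have H (l : nat) : (z ^+ l)%g i = z i * l%:Z.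
  by elim: l => [|l IH]; [rewrite expg0 ffunE mulr0 | rewrite expgS ffunE IH; lia].
by case: m => m; rewrite /= ?ffunE H //; lia.
Qed.

Lemma extcol_mutate s k i t : is_seed s -> i != k ->
  extcol (mutate k s) i t =
  extcol s i t + Num.max (seedB s k i) 0 * extcol s k t +
  seedB s k i * (negpart (extcol s k) t - 2%:Z * avar k t).
Proof.
move=> /(diag0 k) Bkk /negPf ik; case: s Bkk => B X A /= Bkk; rewrite !ffunE.
case: t => j /=.
  rewrite ?ffunE ik ?ffunE ?expgz_trop ?ffunE /=.
  move: (X i j) (X k j) => a c.
  by rewrite (_ : Num.max (- c) 0 = - Num.min 0 c); [ring | lia].
rewrite mxE ik orbF (inj_eq inr_inj); case: eqP => [->|jk]; first by rewrite Bkk; lia.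
set b := B k i; set c := B j k.
by case: (sgrP c) => H; rewrite ?H; case: (leP 0 b) => Hb; nia.
Qed.

(** Independence of the columns of the extended exchange matrix. *)
Definition full_rank s : Prop := forall w : 'I_n -> int,
  (forall t, \sum_i w i * extcol s i t = 0) -> forall i, w i = 0.

(** Mutation multiplies the extended matrix on both sides by unimodular
    matrices; w is the image of w' under the one acting on columns, and S the
    contribution of the one acting on rows, which vanishes by row k. *)
Lemma full_rank_mutate s k : is_seed s -> full_rank s -> full_rank (mutate k s).
Proof.
move=> ss fr w' E.
pose b i := seedB s k i.
pose w i := if i == k then - w' k + \sum_(j | j != k) Num.max (b j) 0 * w' j else w' i.
pose S := \sum_(i | i != k) b i * w' i.
have bk : b k = 0 := diag0 k ss.
have key t : \sum_i w' i * extcol (mutate k s) i t =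
    \sum_i w i * extcol s i t + S * (negpart (extcol s k) t - 2%:Z * avar k t).
  rewrite (bigD1 k) //= [in RHS](bigD1 k) //= extcol_mutate_self ffunE /w eqxx.
  rewrite [X in _ + X = _](_ : _ = \sum_(i | i != k) w' i * extcol s i t +
      (\sum_(j | j != k) Num.max (b j) 0 * w' j) * extcol s k t +
      S * (negpart (extcol s k) t - 2%:Z * avar k t)); last first.
    rewrite /S !big_distrl -!big_split /=; apply: eq_bigr => i ik.
    by rewrite extcol_mutate // /b; ring.
  rewrite [X in _ = _ + X + _](_ : _ = \sum_(i | i != k) w' i * extcol s i t); last first.
    by apply: eq_bigr => i /negPf ->.
  by ring.
have S0 : S = 0.
  have := E (inr k); rewrite key !ffunE eqxx /= (diag0 k ss).
  rewrite (bigD1 k) //= !ffunE (diag0 k ss) mulr0 add0r.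
  rewrite (eq_bigr (fun i => b i * w' i)) -/S => [|i /negPf ik].
    by rewrite oppr0 maxxx; lia.
  by rewrite /w ik !ffunE mulrC.
have w0 : forall i, w i = 0.
  by apply: fr => t; rewrite -[RHS](E t) key S0 mul0r addr0.
have w'0 i : i != k -> w' i = 0 by move=> /negPf ik; have := w0 i; rewrite /w ik.
move=> i; have [->|] := eqVneq i k; last exact: w'0.
have := w0 k; rewrite /w eqxx big1 ?addr0 => [|j /w'0 ->]; last by rewrite mulr0.
by move/eqP; rewrite oppr_eq0 => /eqP.
Qed.

Lemma full_rank_neq0 s k : full_rank s -> extcol s k != 0.
Proof.
move=> fr; apply/eqP => yk0.
have := fr (fun i => (i == k)%:Z) _ k; rewrite eqxx => H.
suff : (1 : int) = 0 by [].
apply: H => t; rewrite (bigD1 k) //= yk0 ffunE mulr0 add0r big1 // => i /negPf ->.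
by rewrite mul0r.
Qed.

(** A nonzero 2 x 2 minor of the columns j and k is a linear functional of the
    second column that kills the first. *)
Lemma full_rank_indep s j k : full_rank s -> j != k ->
  exists lam : expo -> int, [/\ {morph lam : u v / u + v >-> u + v},
    lam (extcol s j) = 0 & lam (extcol s k) != 0].
Proof.
move=> fr jk; set y := extcol s j; set z := extcol s k.
have [[p [q pq]]|H] := classic (exists p q, y p * z q - y q * z p != 0).
  exists (fun u => y p * u q - y q * u p); split=> //; last by ring.
  by move=> u v; rewrite !ffunE; ring.
have {}H p q : y p * z q = y q * z p.
  apply/eqP; rewrite -subr_eq0; apply: contraT => pq.
  by case: H; exists p, q.
have yp p : y p = 0.
  have kj : (k == j) = false by rewrite eq_sym (negPf jk).
  have := fr (fun i => (i == k)%:Z * y p - (i == j)%:Z * z p) _ k.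
  rewrite eqxx kj mul0r subr0 mul1r; apply=> t.
  rewrite (bigD1 j) // (bigD1 k) ?kj //= big1 => [|i /andP[/negPf-> /negPf->]].
    rewrite ?eqxx ?(negPf jk) ?kj -/y -/z; have := H t p.
    by move: (y t) (z p) (y p) (z t) => a b c d; nia.
  by move: (y p) (z p) (extcol s i t) => a b c; lia.
case/eqP: (full_rank_neq0 j fr); apply/ffunP => t.
by rewrite -/y yp ffunE.
Qed.

End Seeds.

(** * Upper cluster algebras *)

Lemma tree_connected (n : nat) (P : tree n -> Prop) :
  (forall k t t', tree_edge k t t' -> P t -> P t') -> forall t0 t, P t0 -> P t.
Proof.
move=> step; pose root : tree n := exist _ [::] isT.
have up t : P root -> P t.
  case: t => w ws Pr; elim: w ws => [|i w IH] ws.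
    by rewrite (_ : exist _ _ _ = root) //; apply: val_inj.
  have ws' : sorted (fun i j => i != j) w by apply: path_sorted ws.
  by apply: (step i (exist _ w ws')) (IH ws'); rewrite /tree_edge /= eqxx.
have down t : P t -> P root.
  case: t => w ws; elim: w ws => [|i w IH] ws Pt.
    by rewrite (_ : root = exist _ [::] ws) //; apply: val_inj.
  have ws' : sorted (fun i j => i != j) w by apply: path_sorted ws.
  by apply: (IH ws'); apply: (step i) Pt; rewrite /tree_edge /= eqxx orbT.
by move=> t0 t /down/up.
Qed.

Lemma tree_neighbour (n : nat) (t : tree n) k : exists t', tree_edge k t t'.
Proof.
case: t => -[|i w] ws.
  have ks : sorted (fun i j : 'I_n => i != j) [:: k] by [].
  by exists (exist _ [:: k] ks); rewrite /tree_edge /= eqxx.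
have [ik|ki] := eqVneq k i; last first.
  have ks : sorted (fun i j : 'I_n => i != j) (k :: i :: w) by rewrite /= ki.
  by exists (exist _ (k :: i :: w) ks); rewrite /tree_edge /= eqxx.
have ws' : sorted (fun i j => i != j) w by apply: path_sorted ws.
by exists (exist _ w ws'); rewrite /tree_edge /= ik eqxx orbT.
Qed.

Section Upper.
Variables (K : idomainType) (n : nat) (F : ambientField K (trop n)).
Implicit Types (s : seed_data F n) (i j k : 'I_n) (t : tree n) (p : F).

Local Notation cl s := (cmono (seedA s)).
Local Notation dir k := (fun u : {ffun 'I_n + 'I_n -> int} => u (inr k)).

Lemma seed_map s : is_seed s -> monomial_map (cl s).
Proof. by case=> _ /free_neq0/cmono_map. Qed.

Lemma extcol_diag s k : is_seed s -> extcol s k (inr k) = 0.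
Proof. by move=> ss; rewrite ffunE; apply: diag0. Qed.

(** The mutation rule of the variables x^(y_j), with denominators cleared
    according to the sign of b_kj. *)

Section MutatedColumn.
Variables (s : seed_data F n) (j k : 'I_n).
Hypotheses (ss : is_seed s) (sk : is_seed (mutate k s)) (jk : j != k).
Let m := absz (seedB s k j).

Let A0 : forall i, seedA s i != 0. Proof. by case: ss => _ /free_neq0. Qed.
Let xM := seed_map ss.
Let xkM := seed_map sk.

Let exchange_pow : cl s (avar k) ^+ m * cl (mutate k s) (avar k) ^+ m =
  cl s (negpart (extcol s k)) ^+ m * (1 + cl s (extcol s k)) ^+ m.
Proof. by rewrite -!exprMn cmono_exchange. Qed.

Lemma cmono_extcol_neg : seedB s k j <= 0 ->
  cl (mutate k s) (extcol (mutate k s) j) =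
  cl s (extcol s j) * (1 + cl s (extcol s k)) ^+ m.
Proof.
move=> b0; set N := negpart (extcol s k); set y := extcol s j.
have -> : extcol (mutate k s) j = (y - N *+ m + avar k *+ m) + avar k *+ m.
  apply/ffunP => t; rewrite extcol_mutate // !ffunE !ffunMnE !ffunE -/y.
  by move: (y t) (extcol s k t) => a c; rewrite /m; case: (t == _); nia.
rewrite (monoD xkM) (monoMn xkM) -cmono_mutate; last first.
  rewrite !ffunE !ffunMnE !ffunE eqxx /= diag0 //.
  by rewrite /m; lia.
rewrite !(monoD xM) (monoN xM) !(monoMn xM) -mulrA exchange_pow.
by field; rewrite expf_neq0 // (mono_neq0 xM).
Qed.

Lemma cmono_extcol_pos : 0 <= seedB s k j ->
  cl (mutate k s) (extcol (mutate k s) j) * (1 + cl s (- extcol s k)) ^+ m =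
  cl s (extcol s j).
Proof.
move=> b0; set N := negpart (extcol s k); set y := extcol s j; set z := extcol s k.
have -> : extcol (mutate k s) j = (y + z *+ m + N *+ m - avar k *+ m) - avar k *+ m.
  apply/ffunP => t; rewrite extcol_mutate // !ffunE !ffunMnE !ffunE -/y -/z.
  by move: (y t) (z t) => a c; rewrite /m; case: (t == _); nia.
rewrite (monoD xkM) (monoN xkM) (monoMn xkM) -cmono_mutate; last first.
  rewrite !ffunE !ffunMnE !ffunE eqxx /= diag0 //.
  by rewrite /m; lia.
have z0 := mono_neq0 xM z.
have -> : 1 + cl s (- z) = (1 + cl s z) / cl s z by rewrite (monoN xM); field.
rewrite expr_div_n !(monoD xM) (monoN xM) !(monoMn xM).
have := exchange_pow; rewrite -/z -/N => E.
have a0 : cl s (avar k) ^+ m != 0 by rewrite expf_neq0 // (mono_neq0 xM).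
have a'0 : cl (mutate k s) (avar k) ^+ m != 0.
  by rewrite expf_neq0 // (mono_neq0 xkM).
apply: (mulIf (mulf_neq0 a0 a'0)); rewrite [in RHS]E.
by field; rewrite a0 a'0 expf_neq0.
Qed.

End MutatedColumn.

(** The base ring R is K in the factorization argument and the ring of integers
    in the proof that F-polynomials are integral. *)

Section Base.
Variables (R : nzRingType) (sc : {rmorphism R -> F}).
Hypothesis sc_free : forall A : 'I_n -> F, free_generating A -> lfree sc (cmono A).

Local Notation laur s p := (laurent sc (cl s) p).

Let seed_free s : is_seed s -> lfree sc (cl s).
Proof. by case=> _ /sc_free. Qed.

(** Membership in the Laurent rings of a seed and of all its neighbours; it
    propagates along the tree, so it is membership in the upper cluster
    algebra. *)
Definition upper s p : Prop := laur s p /\ forall j, laur (mutate j s) p.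

Lemma exchange_span s k : is_seed s -> forall A : 'I_n -> F,
  (forall u : {ffun 'I_n + 'I_n -> int}, u (inr k) = 0 -> cl s u = cmono A u) ->
  span sc (cmono A) (degeq (dir k) 0)
    (cl s (negpart (extcol s k)) * (1 + cl s (extcol s k))).
Proof.
move=> ss A sA; have y0 := extcol_diag k ss.
have N0 : negpart (extcol s k) (inr k) = 0 by rewrite ffunE y0 oppr0 maxxx.
have Np0 : (negpart (extcol s k) + extcol s k) (inr k) = 0 by rewrite ffunE N0 y0.
rewrite mulrDr mulr1 -(monoD (seed_map ss)) (sA _ N0) (sA _ Np0).
by apply: spanD; apply: span_mono; rewrite /degeq ?N0 ?Np0.
Qed.

Lemma square_seeds s j k p : is_seed s -> is_seed (mutate j s) ->
  is_seed (mutate k s) -> is_seed (mutate j (mutate k s)) -> full_rank s ->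
  j != k -> laur s p -> laur (mutate j s) p -> laur (mutate k s) p ->
  laur (mutate j (mutate k s)) p.
Proof.
move=> ss sj sk sjk fr jk.
have kj : (k == j) = false by rewrite eq_sym (negPf jk).
have A0 s' : is_seed s' -> forall i, seedA s' i != 0 by case=> _ /free_neq0.
have dk := extcol_diag k ss; have dj := extcol_diag j ss.
have dj' := extcol_diag j sk.
apply: (@square_laurent _ _ sc _ (cl s) (cl (mutate j s)) (cl (mutate k s))
  (cl (mutate j (mutate k s))) (dir j) (dir k)
  (avar j) (avar k) (extcol s j) (extcol s k) (extcol (mutate k s) j)
  (negpart (extcol s j)) (negpart (extcol s k)) (negpart (extcol (mutate k s) j))
  (seed_map ss) (seed_map sj) (seed_map sk) (seed_map sjk)
  (seed_free ss) (seed_free sjk) (coorD _) (coorD _)) => //.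
- by rewrite ffunE eqxx.
- by rewrite ffunE (inj_eq inr_inj) kj.
- by rewrite ffunE (inj_eq inr_inj) (negPf jk).
- by rewrite ffunE eqxx.
- by move=> u; apply: cmono_mutate.
- by move=> u; apply: cmono_mutate.
- by move=> u; apply: cmono_mutate.
- by rewrite ffunE dj oppr0 maxxx.
- by rewrite ffunE dk oppr0 maxxx.
- by rewrite ffunE dj' oppr0 maxxx.
- by rewrite ffunE.
- by rewrite !ffunE; apply: skew_sign.
- by apply: cmono_exchange; apply: A0.
- by apply: cmono_exchange; apply: A0.
- rewrite -(cmono_exchange j (A0 _ sk)); congr (_ * _); apply: cmono_mutate.
  by rewrite ffunE (inj_eq inr_inj) kj.
- by rewrite ffunE; apply: cmono_extcol_neg.
- by rewrite ffunE; apply: cmono_extcol_pos.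
- exact: full_rank_neq0.
- exact: full_rank_indep.
Qed.

Section Pattern.
Variable Sigma : tree n -> seed_data F n.
Hypothesis Sigma_pattern : seed_pattern Sigma.

Lemma pattern_mutate t k : exists t', tree_edge k t t' /\ mutate k (Sigma t) = Sigma t'.
Proof.
have [t' e] := tree_neighbour t k; exists t'; split=> //.
by rewrite (Sigma_pattern.2 _ _ _ e).
Qed.

Lemma pattern_seed t : is_seed (Sigma t). Proof. exact: Sigma_pattern.1. Qed.

Lemma pattern_seed_mutate t k : is_seed (mutate k (Sigma t)).
Proof. by have [t' [_ ->]] := pattern_mutate t k; apply: pattern_seed. Qed.

Lemma pattern_mutateK t k : mutate k (mutate k (Sigma t)) = Sigma t.
Proof.
have [t' [e ->]] := pattern_mutate t k; symmetry; apply: Sigma_pattern.2.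
by rewrite /tree_edge orbC.
Qed.

Lemma pattern_ind (P : seed_data F n -> Prop) :
  (forall t k, P (Sigma t) -> P (mutate k (Sigma t))) ->
  forall t0 t, P (Sigma t0) -> P (Sigma t).
Proof.
move=> step; apply: (@tree_connected n (fun t => P (Sigma t))) => k t t' e Pt.
by rewrite (Sigma_pattern.2 _ _ _ e); apply: step.
Qed.

Lemma pattern_full_rank t0 : full_rank (Sigma t0) -> forall t, full_rank (Sigma t).
Proof.
move=> fr t; apply: pattern_ind fr => t1 k.
exact: full_rank_mutate (pattern_seed t1).
Qed.

(** Membership at the neighbours of a neighbour is membership in the far
    corner of a square of mutations. *)
Lemma upper_invariant t0 : full_rank (Sigma t0) ->
  forall t t' p, upper (Sigma t) p -> upper (Sigma t') p.
Proof.
move=> fr t t' p; apply: (pattern_ind (P := fun s => upper s p)) => {t t'} t k [l ln].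
split=> // j; have [->|jk] := eqVneq j k; first by rewrite pattern_mutateK.
apply: (square_seeds (s := Sigma t)) => //; try exact: pattern_seed_mutate.
- exact: pattern_seed.
- have [t' [_ ->]] := pattern_mutate t k; exact: pattern_seed_mutate.
- exact: pattern_full_rank fr t.
Qed.

Lemma seed_mono_laur s k (u : {ffun 'I_n + 'I_n -> int}) : is_seed s -> is_seed (mutate k s) -> 0 <= u (inr k) ->
  laur (mutate k s) (cl s u).
Proof.
move=> ss sk; have A0 i : seedA s i != 0 by case: ss => _ /free_neq0.
apply: (adj_mono (seed_map ss) (seed_map sk) (al := dir k) (coorD _)
  (e := avar k)).
- by rewrite ffunE eqxx.
- by move=> v; apply: cmono_mutate.
- exact: cmono_exchange.
- by apply: exchange_span.
Qed.

Lemma upper_cluster_var t k : upper (Sigma t) (seedA (Sigma t) k).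
Proof.
have st := pattern_seed t; rewrite -cmono_avar; split; first exact: lau_mono.
move=> j; apply: seed_mono_laur => //; first exact: pattern_seed_mutate.
by rewrite ffunE.
Qed.

End Pattern.
End Base.
End Upper.

(** * Polynomials in the degree zero variables *)

Section DegreeZero.
Variables (R : idomainType) (n : nat) (F : fieldType) (sc : {rmorphism R -> F}).
Local Notation expo := {ffun 'I_n + 'I_n -> int}.
Variables (x : expo -> F) (y : 'I_n -> expo).
Hypotheses (x_free : lfree sc x) (xM : monomial_map x).
Hypothesis y_inl : forall i j, y i (inl j) = (i == j)%:Z.
Implicit Types (f h : {mpoly R[n]}) (a p q : F) (u v : expo).

Definition yeval f : F := mmap sc (fun i => x (y i)) f.

HB.instance Definition _ := GRing.RMorphism.copy yeval
  (mmap sc (fun i => x (y i))).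

Definition yexp (m : 'X_{1..n}) : expo := \sum_i y i *+ m i.

(** Membership in the monoid spanned by the y_i; the first coordinates of an
    exponent are its coefficients on the y_i. *)
Definition ycone : pred expo := fun u =>
  [forall t, degeq (fun u => u t - \sum_i u (inl i) * y i t) 0 u] &&
  [forall i, degge (fun u => u (inl i)) 0 u].

Lemma yexpE m t : yexp m t = \sum_i (m i)%:Z * y i t.
Proof. by rewrite /yexp sum_ffunE; apply: eq_bigr => i _; rewrite ffunMnE -mulr_natl natz. Qed.

Lemma yexp_inl m i : yexp m (inl i) = (m i)%:Z.
Proof.
rewrite yexpE (bigD1 i) //= y_inl eqxx mulr1 big1 ?addr0 // => j ji.
by rewrite y_inl (negPf ji) mulr0.
Qed.

Lemma yexp_inj : injective yexp.
Proof.
move=> m m' E; apply/mnmP => i.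
by have := congr1 (fun u : expo => u (inl i)) E; rewrite !yexp_inl => -[].
Qed.

Lemma ycone_yexp m : ycone (yexp m).
Proof.
apply/andP; split; apply/forallP => t; rewrite ?/degge ?/degeq.
  rewrite yexpE subr_eq0; apply/eqP; apply: eq_bigr => i _.
  by rewrite yexp_inl.
by rewrite yexp_inl.
Qed.

Lemma yconeP u : ycone u -> exists m, u = yexp m /\ forall i, (m i)%:Z = u (inl i).
Proof.
move=> /andP[/forallP H /forallP H'].
have mE i : ([multinom absz (u (inl j))%R | j < n] i)%:Z = u (inl i).
  by rewrite mnmE; move: (H' i); rewrite /degge; move: (u (inl i)) => a; lia.
exists [multinom absz (u (inl i))%R | i < n]; split=> //.
apply/ffunP => t; rewrite yexpE; have /eqP/subr0_eq -> := H t.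
by apply: eq_bigr => i _; rewrite mE.
Qed.

Lemma yeval_X m : yeval 'X_[m] = x (yexp m).
Proof.
rewrite /yeval mmapX /mmap1 /yexp (big_morph x (monoD xM) (mono0 xM)).
by apply: eq_bigr => i _; rewrite (monoMn xM).
Qed.

Lemma yevalZ c f : yeval (c *: f) = sc c * yeval f.
Proof. exact: mmapZ. Qed.

Lemma yevalE f : yeval f = \sum_(m <- msupp f) sc f@_m * x (yexp m).
Proof.
rewrite {1}[f]mpolyE rmorph_sum; apply: eq_bigr => m _.
by rewrite /= yevalZ yeval_X.
Qed.

Lemma yeval_span f : span sc x ycone (yeval f).
Proof.
rewrite yevalE; elim: (msupp f) => [|m s IH]; first by rewrite big_nil; apply: span0.
by rewrite big_cons; apply: spanD => //; apply/span_term/ycone_yexp.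
Qed.

Lemma yeval_inj : injective yeval.
Proof.
apply: raddf_inj => f /= f0; apply/mpolyP => m; rewrite mcoeff0.
pose zm u : 'X_{1..n} := [multinom absz (u (inl i))%R | i < n].
have zmK : cancel yexp zm by move=> m'; apply/mnmP => i; rewrite mnmE yexp_inl.
have [mf|/memN_msupp_eq0//] := boolP (m \in msupp f).
rewrite -[m in LHS]zmK.
apply: (x_free (s := map yexp (msupp f)) (c := fun u => f@_(zm u))).
- by rewrite map_inj_uniq ?msupp_uniq //; apply: yexp_inj.
- by rewrite -[RHS]f0 yevalE big_map; apply: eq_bigr => i _; rewrite zmK.
- exact: map_f.
Qed.

(** Nonvanishing at this point witnesses that the j-th variable does not divide
    a polynomial. *)
Definition all_but j : 'I_n -> R := fun i => (i != j)%:R.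

Lemma span_ycone p : span sc x ycone p -> exists f, p = yeval f.
Proof.
move: p; apply: span_ind => [|c u /yconeP[m [-> _]]|p q [f ->] [h ->]].
- by exists 0; rewrite rmorph0.
- by exists (c *: 'X_[m]); rewrite yevalZ yeval_X.
- by exists (f + h); rewrite rmorphD.
Qed.

Lemma all_butX j (m : 'X_{1..n}) : 'X_[m].@[all_but j] = (m j == 0%N)%:R.
Proof.
rewrite mevalX (bigD1 j) //= big1 ?mulr1 => [|i ij].
  by rewrite /all_but eqxx expr0n.
by rewrite /all_but ij expr1n.
Qed.

Lemma span_ycone_pos j f :
  span sc x (fun u => ycone u && (u (inl j) != 0)) (yeval f) ->
  f.@[all_but j] = 0.
Proof.
move=> Cf; suff [h E h0] : exists2 h, yeval f = yeval h & h.@[all_but j] = 0.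
  by rewrite (yeval_inj E).
move: (yeval f) Cf; apply: span_ind => [|c u /andP[/yconeP[m [-> mE]] uj]|p q [h -> h0] [h' -> h'0]].
- by exists 0; rewrite ?rmorph0.
- exists (c *: 'X_[m]); first by rewrite yevalZ yeval_X.
  move: uj; rewrite yexp_inl eqz_nat mevalZ all_butX => /negPf ->.
  by rewrite mulr0.
- exists (h + h'); first by rewrite rmorphD.
  by rewrite mevalD h0 h'0 addr0.
Qed.

Lemma yeval_monomial f c u : c != 0 -> yeval f = sc c * x u ->
  exists2 m, u = yexp m & f = c *: 'X_[m].
Proof.
move=> c0 E; have [cu|cu] := boolP (ycone u).
  have [m [um _]] := yconeP cu; exists m => //.
  by apply: yeval_inj; rewrite yevalZ yeval_X E um.
have : sc c * x u = 0.
  apply: (span_disjoint (C := ycone) (D := fun v => ~~ ycone v) x_free).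
  - by move=> v ->.
  - by rewrite -E; apply: yeval_span.
  - exact: span_term.
move/eqP; rewrite mulf_eq0 (negPf (mono_neq0 xM u)) orbF => /eqP/(sc_inj x_free).
by move/eqP; rewrite (negPf c0).
Qed.

Let ydegD t : {morph (fun u : expo => u t - \sum_i u (inl i) * y i t) :
  u v / u + v >-> u + v}.
Proof.
move=> u v; rewrite ffunE addrACA -opprD -big_split /=; congr (_ - _).
by apply: eq_bigr => i _; rewrite ffunE mulrDl.
Qed.

(** The part of p of nonzero degree would give a product in nonzero degree. *)
Lemma span0_quot (lam : expo -> int) p q :
  {morph lam : u v / u + v >-> u + v} -> laurent sc x p -> q != 0 ->
  span sc x (degeq lam 0) q -> span sc x (degeq lam 0) (p * q) ->
  span sc x (degeq lam 0) p.
Proof.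
move=> lamD lp q0 Cq Cpq.
have [p1 [p2 [ep Cp1 Cp2]]] := span_split (degeq lam 0) lp.
have {}Cp1 : span sc x (degeq lam 0) p1 by apply: span_imp Cp1 => u /andP[].
have : p2 * q = 0.
  apply: (span_disjoint (C := fun u => ~~ degeq lam 0 u) (D := degeq lam 0) x_free) => //.
    by apply: (spanM xM) Cp2 Cq => u v; rewrite /degeq lamD /=; lia.
  rewrite (_ : _ * q = p * q - p1 * q); last by rewrite ep; ring.
  apply: spanB => //; apply: (spanM xM) Cp1 Cq => u v.
  by rewrite /degeq lamD; lia.
by move/eqP; rewrite mulf_eq0 (negPf q0) orbF ep => /eqP ->; rewrite addr0.
Qed.

(** A lowest component of p in negative degree would survive in the product,
    multiplied by q0. *)
Lemma span_ge0_quot (lam : expo -> int) p q0 q1 :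
  {morph lam : u v / u + v >-> u + v} -> laurent sc x p -> q0 != 0 ->
  span sc x (degeq lam 0) q0 -> span sc x (deggt lam 0) q1 ->
  span sc x (degge lam 0) (p * (q0 + q1)) -> span sc x (degge lam 0) p.
Proof.
move=> lamD lp q00 Cq0 Cq1 Cpq.
have [->|p0] := eqVneq p 0; first exact: span0.
have [d [pd [pd0 Cpd Cp]]] := span_low x_free lam lp p0.
have [d0|d0] := leP 0 d.
  rewrite -(subrK pd p); apply: spanD; [apply: span_imp Cp | apply: span_imp Cpd];
    by move=> u; rewrite /degge /deggt /degeq; lia.
have : pd * q0 = 0.
  apply: (span_disjoint (C := degeq lam d) (D := deggt lam d) x_free).
  - by move=> u; rewrite /degeq /deggt; lia.
  - by apply: (spanM xM) Cpd Cq0 => u v; rewrite /degeq lamD; lia.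
  rewrite (_ : _ * q0 = p * (q0 + q1) - (p - pd) * (q0 + q1) - pd * q1); last by ring.
  have Cq : span sc x (degge lam 0) (q0 + q1).
    apply: spanD; [apply: span_imp Cq0 | apply: span_imp Cq1];
      by move=> u; rewrite /degge /deggt /degeq; lia.
  apply: spanB; first apply: spanB.
  - by apply: span_imp Cpq => u; rewrite /degge /deggt; lia.
  - by apply: (spanM xM) Cp Cq => u v; rewrite /degge /deggt lamD; lia.
  - by apply: (spanM xM) Cpd Cq1 => u v; rewrite /degeq /deggt lamD; lia.
by move/eqP; rewrite mulf_eq0 (negPf pd0) (negPf q00).
Qed.

(** The quotient has degree zero since dividend and divisor do, and it has no
    pole along the j-th variable since that variable does not divide f. *)
Lemma yeval_quot a f h : laurent sc x a -> f != 0 ->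
  (forall j, f.@[all_but j] != 0) -> a * yeval f = yeval h ->
  exists2 f', a = yeval f' & f' * f = h.
Proof.
move=> la f0 fj E.
have q0 : yeval f != 0.
  by apply: contra f0 => /eqP; rewrite -(rmorph0 yeval) => /yeval_inj/eqP.
have Ch := yeval_span h; have Cf := yeval_span f.
have [] : exists f', a = yeval f'; last first.
  by move=> f' ea; exists f' => //; apply: yeval_inj; rewrite rmorphM /= -ea E.
apply: span_ycone; apply: (span_conj x_free); apply: (span_forall x_free la).
  move=> t; apply: (span0_quot (@ydegD t) la q0).
    by apply: span_imp Cf => u /andP[/forallP].
  by rewrite E; apply: span_imp Ch => u /andP[/forallP].
move=> j; have [q1 [q2 [eq Cq1 Cq2]]] := span_split (degeq (fun u => u (inl j)) 0) Cf.
apply: (span_ge0_quot (q0 := q1) (q1 := q2) (coorD _) la).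
- apply: contra (fj j) => /eqP q10; apply/eqP/span_ycone_pos.
  by rewrite eq q10 add0r; apply: span_imp Cq2 => u; rewrite /degeq.
- by apply: span_imp Cq1 => u /andP[].
- apply: span_imp Cq2 => u /andP[/andP[_ /forallP/(_ j)]].
  by rewrite /degge /degeq /deggt; lia.
- by rewrite -eq E; apply: span_imp Ch => u /andP[_ /forallP/(_ j)].
Qed.

End DegreeZero.

(** * Cluster variables with principal coefficients *)

Section Principal.
Variables (K : idomainType) (n : nat) (F : ambientField K (trop n)).
Hypothesis K_char0 : [pchar K] =i pred0.
Variables (Sigma : tree n -> seed_data F n) (t0 : tree n).
Hypothesis Sigma_pattern : seed_pattern Sigma.
Hypothesis Sigma_principal : principal_coefficients Sigma t0.
Local Notation expo := {ffun 'I_n + 'I_n -> int}.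
Local Notation cl s := (cmono (seedA s)).
Local Notation x0 := (cl (Sigma t0)).
Local Notation y0 := (extcol (Sigma t0)).
Local Notation dir k := (fun u : expo => u (inr k)).
Implicit Types (i j k l : 'I_n) (t : tree n) (p : F) (u v : expo).

(** The integers as a second base ring; positivity makes sense over it. *)
Definition intF : {rmorphism int -> F} := intmul 1.

Lemma intr_eq0 (z : int) : (z%:~R == 0 :> K) = (z == 0).
Proof.
have /pcharf0P nat0 := K_char0.
by case: z => m; [exact: nat0 | rewrite NegzE rmorphN !oppr_eq0; exact: nat0].
Qed.

Lemma intF_free (A : 'I_n -> F) : free_generating A -> lfree intF (cmono A).
Proof.
move=> /cmono_free Afree s c us E u us_u; apply/eqP; rewrite -intr_eq0; apply/eqP.
apply: (Afree s (fun u => (c u)%:~R) us _ u us_u).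
by rewrite -[RHS]E; apply: eq_bigr => v _; rewrite rmorph_int.
Qed.

Lemma initial_inl i j : y0 i (inl j) = (i == j)%:Z.
Proof. by rewrite ffunE Sigma_principal ffunE. Qed.

Lemma initial_full_rank : full_rank (Sigma t0).
Proof.
move=> w E i; have := E (inl i); rewrite (bigD1 i) //= initial_inl eqxx mulr1.
rewrite big1 ?addr0 // => j ji.
by rewrite initial_inl (negPf ji) mulr0.
Qed.

Let s0 : is_seed (Sigma t0) := pattern_seed Sigma_pattern t0.
Let x0M : monomial_map x0 := seed_map s0.
Let x0Z_free : lfree intF x0 := intF_free s0.2.

Local Notation yZ := (yeval intF x0 y0).

Definition clusterexp (g : 'I_n -> int) : expo :=
  [ffun e => match e with inl _ => 0 | inr l => g l end].

(** The degree, in the grading in which the initial cluster variables are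
    independent and the y_i have degree zero, of the monomial of exponent u in
    a cluster whose i-th variable has degree g i. *)
Definition gdeg (g : 'I_n -> 'I_n -> int) u l : int :=
  \sum_i u (inr i) * g i l - \sum_i u (inl i) * y0 i (inr l).

Lemma gdeg_lin g (u v w r : expo) (c d : int) l :
  (forall e, w e = u e + c * v e + d * r e) ->
  gdeg g w l = gdeg g u l + c * gdeg g v l + d * gdeg g r l.
Proof.
move=> E; have lin (h : 'I_n -> int) (o : 'I_n -> 'I_n + 'I_n) :
    \sum_i w (o i) * h i = \sum_i u (o i) * h i + c * \sum_i v (o i) * h i
                           + d * \sum_i r (o i) * h i.
  rewrite !mulr_sumr -!big_split /=; apply: eq_bigr => i _.
  by rewrite E; ring.
by rewrite /gdeg (lin _ inl) (lin _ inr); ring.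
Qed.

(** The F-polynomial of the monomial of exponent u in a cluster whose
    variables have F-polynomials f. *)
Definition numerator (f : 'I_n -> {mpoly int[n]}) u : {mpoly int[n]} :=
  'X_[[multinom absz (u (inl i)) | i < n]] * \prod_i f i ^+ absz (u (inr i)).

Lemma cmono_numerator (A : 'I_n -> F) g f u :
  (forall i, A i = x0 (clusterexp (g i)) * yZ (f i)) -> (forall e, 0 <= u e) ->
  cmono A u = x0 (clusterexp (gdeg g u)) * yZ (numerator f u).
Proof.
move=> AE u0; set zm := [multinom absz (u (inl i)) | i < n].
pose cu : expo := [ffun e => match e with inl i => u (inl i) | inr _ => 0 end].
pose zg : 'I_n -> int := fun l => - \sum_i u (inl i) * y0 i (inr l).
have cuE : cu = clusterexp zg + yexp y0 zm.
  apply/ffunP => -[] i; rewrite !ffunE ?(yexp_inl initial_inl) ?yexpE.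
    by rewrite add0r mnmE; have := u0 (inl i); move: (u (inl i)) => a; lia.
  rewrite /zg addrC; apply/esym/eqP; rewrite subr_eq0; apply/eqP.
  apply: eq_bigr => j _; rewrite mnmE.
  by have := u0 (inl j); move: (u (inl j)) => a a0; congr (_ * _); lia.
have -> : cmono A u = x0 cu * \prod_i A i ^ u (inr i).
  rewrite /cmono; congr (_ * _).
  rewrite big1 ?mulr1 => [|i _]; last by rewrite ffunE expr0z.
  by congr (coef F _); apply/ffunP => i; rewrite !ffunE.
have -> : \prod_i A i ^ u (inr i) =
    x0 (\sum_i clusterexp (g i) *+ absz (u (inr i))) *
    yZ (\prod_i f i ^+ absz (u (inr i))).
  rewrite rmorph_prod (big_morph _ (monoD x0M) (mono0 x0M)) -big_split /=.
  apply: eq_bigr => i _; rewrite rmorphXn (monoMn x0M) -exprMn -AE.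
  by have := u0 (inr i); case: (u (inr i)).
rewrite cuE (monoD x0M) -(yeval_X intF y0 x0M) mulrACA -rmorphM -(monoD x0M).
congr (x0 _ * _); apply/ffunP => t; rewrite !ffunE sum_ffunE.
rewrite (eq_bigr (fun i => clusterexp (g i) t * (absz (u (inr i)))%:Z)); last first.
  by move=> i _; rewrite ffunMnE -mulr_natr natz.
case: t => l; first by rewrite big1 ?addr0 // => i _; rewrite ffunE mul0r.
rewrite /zg /gdeg addrC; congr (_ - _); apply: eq_bigr => i _; rewrite ffunE mulrC.
by have := u0 (inr i); move: (u (inr i)) => a a0; congr (_ * _); lia.
Qed.

(** Only the coefficient part of the monomial can vanish at the point where
    the j-th variable is 0. *)
Lemma numerator_eval (f : 'I_n -> {mpoly int[n]}) u j :
  (forall i, 0 < (f i).@[all_but int j]) ->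
  0 <= (numerator f u).@[all_but int j] /\
  (u (inl j) = 0 -> 0 < (numerator f u).@[all_but int j]).
Proof.
move=> f0; rewrite /numerator mevalM all_butX mnmE rmorph_prod /=.
have P0 : 0 < \prod_i (f i ^+ absz (u (inr i))).@[all_but int j].
  by apply: prodr_gt0 => i _; rewrite rmorphXn; apply/exprn_gt0/f0.
split; first by case: (_ == _); rewrite ?mul0r // mul1r ltW.
by move=> ->; rewrite mul1r.
Qed.

(** The separation of additions of Fomin and Zelevinsky, for a whole seed. The
    values at all_but are asked to be positive, not only nonzero, since
    positivity is what exchange relations propagate; the last condition says
    that both terms of each exchange relation have the same degree. *)
Definition separated (s : seed_data F n) : Prop :=
  exists (g : 'I_n -> 'I_n -> int) (f : 'I_n -> {mpoly int[n]}),
  [/\ forall i, seedA s i = x0 (clusterexp (g i)) * yZ (f i),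
      forall i j, 0 < (f i).@[all_but int j] &
      forall i l, gdeg g (extcol s i) l = 0].

(** The new variable is a Laurent quotient of two elements in separated form,
    so yeval_quot produces its F-polynomial f', and the value of f' at all_but
    is positive as a quotient of positive values. *)
Lemma separated_mutate t k : separated (Sigma t) -> separated (mutate k (Sigma t)).
Proof.
move=> [g [f [AE f0 g0]]]; have st := pattern_seed Sigma_pattern t.
have stk := pattern_seed_mutate Sigma_pattern t k.
have A0 i : seedA (Sigma t) i != 0 by case: st => _ /free_neq0.
set y := extcol (Sigma t) k.
pose gN := gdeg g (negpart y); pose h := numerator f (pospart y) + numerator f (negpart y).
have gP l : gdeg g (pospart y) l = gN l.
  rewrite (@gdeg_lin g y (negpart y) _ 0 1 0) ?g0 ?add0r ?mul1r ?mul0r ?addr0 // => t'.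
  by rewrite pospartE !ffunE; ring.
have PE : exchange_binomial (Sigma t) k = x0 (clusterexp gN) * yZ h.
  rewrite exchange_binomialE !(cmono_numerator AE) => [|t'|t'].
  - rewrite -/y (_ : clusterexp (gdeg g (pospart y)) = clusterexp gN).
      by rewrite -mulrDr -rmorphD.
    by apply/ffunP => -[] l; rewrite !ffunE.
  - by rewrite ffunE; move: (extcol _ k t') => a; lia.
  - by rewrite ffunE; move: (extcol _ k t') => a; lia.
have [f' f'E f'f] : exists2 f', seedA (mutate k (Sigma t)) k =
    x0 (clusterexp gN - clusterexp (g k)) * yZ f' & f' * f k = h.
  pose a := x0 (clusterexp (g k) - clusterexp gN) * seedA (mutate k (Sigma t)) k.
  have la : laurent intF x0 a.
    apply: (lauM x0M); first exact: lau_mono.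
    have [t' [_ ->]] := pattern_mutate Sigma_pattern t k.
    have U : upper intF (Sigma t') (seedA (Sigma t') k) by apply: upper_cluster_var.
    exact: (upper_invariant intF_free Sigma_pattern initial_full_rank t0 U).1.
  have fk0 : f k != 0.
    by apply: contraTneq (f0 k k) => ->; rewrite meval0 ltxx.
  have fkj j : (f k).@[all_but int j] != 0 by rewrite gt_eqF.
  have [|f' aE f'f] := yeval_quot x0Z_free x0M initial_inl (h := h) la fk0 fkj.
    rewrite /a seedA_mutate eqxx PE (monoD x0M) (monoN x0M) AE.
    have yf0 : yZ (f k) != 0.
      by have := A0 k; rewrite AE mulf_eq0 negb_or => /andP[].
    field; rewrite yf0 (mono_neq0 x0M) /=.
    exact: (mono_neq0 x0M).
  exists f' => //; rewrite -aE /a mulrA -(monoD x0M).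
  by rewrite addrA subrK subrr (mono0 x0M) mul1r.
pose g' i := if i == k then fun l => gN l - g k l else g i.
have dg u l : gdeg g' u l = gdeg g u l + u (inr k) * (gN l - g k l - g k l).
  rewrite /gdeg (bigD1 k) //= [in RHS](bigD1 k) //= /g' eqxx.
  rewrite (eq_bigr (fun i => u (inr i) * g i l)); last by move=> i /negPf ->.
  by ring.
exists g', (fun i => if i == k then f' else f i); split.
- move=> i; rewrite /g'; case: eqP => [->|/eqP/negPf ik].
    rewrite f'E; congr (x0 _ * _); apply/ffunP => -[] l; rewrite !ffunE //.
  by rewrite seedA_mutate ik AE.
- move=> i j; case: eqP => _ //.
  have f'j : f'.@[all_but int j] * (f k).@[all_but int j] = h.@[all_but int j].
    by rewrite -mevalM f'f.
  have hj : 0 < h.@[all_but int j].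
    rewrite mevalD.
    have [Np Np'] := numerator_eval (negpart y) (f0 ^~ j).
    have [Pp Pp'] := numerator_eval (pospart y) (f0 ^~ j).
    (* One of the two terms does not involve the variable set to 0. *)
    have [yj|yj] := leP 0 (y (inl j)).
      by apply: ltr_wpDl => //; apply: Np'; rewrite ffunE; move: (y _) yj => a; lia.
    by apply: ltr_pwDl => //; apply: Pp'; rewrite ffunE; move: (y _) yj => a; lia.
  by rewrite -(pmulr_lgt0 _ (f0 k j)) f'j.
- move=> i l; rewrite dg; have [->|ik] := eqVneq i k.
    rewrite extcol_mutate_self (@gdeg_lin g 0 y _ 0 (-1) 0); last first.
      by move=> t'; rewrite -/y [LHS]ffunE [(0 : expo) t']ffunE; ring.
    rewrite ffunE (extcol_diag k st) g0.
    by rewrite /gdeg !big1 ?mulr0 ?mul0r ?addr0 ?subrr // => i' _; rewrite ffunE mul0r.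
  set b := seedB (Sigma t) k i.
  have kdeg : gdeg g (avar k) l = g k l.
    rewrite /gdeg (bigD1 k) //= ffunE eqxx mul1r !big1 ?addr0 ?subr0 // => i' ik'.
      by rewrite ffunE mul0r.
    by rewrite ffunE (inj_eq inr_inj) (negPf ik') mul0r.
  pose r : expo := [ffun e => negpart y e - 2%:Z * avar k e].
  have rE e : r e = negpart y e - 2%:Z * avar k e by rewrite /r ffunE.
  have rdeg : gdeg g r l = gN l - g k l - g k l.
    rewrite (@gdeg_lin g (negpart y) (avar k) _ 0 (- 2%:Z) 0) ?kdeg => [|e].
      by rewrite -/(gN l); ring.
    by rewrite rE; ring.
  rewrite (@gdeg_lin g (extcol (Sigma t) i) y _ r (Num.max b 0) b); last first.
    by move=> e; rewrite extcol_mutate // -/y -/b rE.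
  have yk0 : y (inr k) = 0 := extcol_diag k st.
  have N0 : negpart y (inr k) = 0 by rewrite ffunE yk0 oppr0 maxxx.
  have ak : avar k (inr k) = 1 by rewrite ffunE eqxx.
  have bE : extcol (Sigma t) i (inr k) = b by rewrite ffunE.
  by rewrite !g0 rdeg extcol_mutate // -/y -/b yk0 N0 ak bE; ring.
Qed.

Lemma separated_initial : separated (Sigma t0).
Proof.
exists (fun i l => (i == l)%:Z), (fun=> 1); split.
- move=> i; rewrite rmorph1 mulr1 -[LHS]cmono_avar; congr (x0 _).
  by apply/ffunP => -[] l; rewrite !ffunE // (inj_eq inr_inj) eq_sym.
- by move=> i j; rewrite meval1.
- move=> i l; rewrite /gdeg (bigD1 l) //= eqxx mulr1 big1 => [|j /negPf ->].
    rewrite addr0 (bigD1 i) //= initial_inl eqxx mul1r big1 => [|j /negPf ji].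
      by rewrite addr0 subrr.
    by rewrite initial_inl eq_sym ji mul0r.
  by rewrite mulr0.
Qed.

Lemma cluster_var_separated t k :
  exists (g : 'I_n -> int) (f : {mpoly int[n]}),
  seedA (Sigma t) k = x0 (clusterexp g) * yZ f /\
  forall j, 0 < f.@[all_but int j].
Proof.
have [g [f [AE f0 _]]] : separated (Sigma t).
  by apply: (pattern_ind Sigma_pattern separated_mutate) separated_initial.
by exists (g k), (f k).
Qed.

End Principal.

(** * Irreducibility *)

Section Irreducibility.
Variables (K : idomainType) (n : nat) (F : ambientField K (trop n)).
Hypothesis K_char0 : [pchar K] =i pred0.
Variables (Sigma : tree n -> seed_data F n) (t0 : tree n).
Hypothesis Sigma_pattern : seed_pattern Sigma.
Hypothesis Sigma_principal : principal_coefficients Sigma t0.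
Local Notation expo := {ffun 'I_n + 'I_n -> int}.
Local Notation cl s := (cmono (seedA s)).
Local Notation s0 := (Sigma t0).
Local Notation x0 := (cl s0).
Local Notation y0 := (extcol s0).
Local Notation laur s p := (laurent (scal F) (cl s) p).
Local Notation yK := (yeval (scal F) x0 y0).
Implicit Types (i j k l : 'I_n) (t : tree n) (p q a : F) (u v z : expo).
Implicit Types (f g h : {mpoly K[n]}).

Let ss t : is_seed (Sigma t) := pattern_seed Sigma_pattern t.
Let sm t j : is_seed (mutate j (Sigma t)) := pattern_seed_mutate Sigma_pattern t j.
Let xM t : monomial_map (cl (Sigma t)) := seed_map (ss t).
Let xmM t j : monomial_map (cl (mutate j (Sigma t))) := seed_map (sm t j).
Let x_free t : lfree (scal F) (cl (Sigma t)) := cmono_free (ss t).2.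
Let xm_free t j : lfree (scal F) (cl (mutate j (Sigma t))) := cmono_free (sm t j).2.
Let y0_inl : forall i j, y0 i (inl j) = (i == j)%:Z := initial_inl Sigma_principal.
Let fr0 : full_rank s0 := initial_full_rank Sigma_principal.
Let fr t : full_rank (Sigma t).
Proof. exact: (pattern_full_rank Sigma_pattern fr0). Qed.

Let A0 t i : seedA (Sigma t) i != 0. Proof. exact: free_neq0 (ss t).2 i. Qed.

Let laur_mutate t j u : 0 <= u (inr j) -> laur (mutate j (Sigma t)) (cl (Sigma t) u).
Proof. exact: seed_mono_laur. Qed.

Let upperK t t' p : upper (scal F) (Sigma t) p -> upper (scal F) (Sigma t') p.
Proof.
exact: (upper_invariant (@cmono_free K n F) Sigma_pattern fr0).
Qed.

Let unit_cancel (c d : K) : c * d = 1 -> c != 0.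
Proof. by move=> cd; apply: contra_eqN cd => /eqP->; rewrite mul0r eq_sym oner_neq0. Qed.

(** In the adjacent Laurent ring the variable at j is not a unit but, up to a
    unit, the binomial 1 + x^y, so divisibility by it is divisibility by a
    prime as soon as a coordinate of y is 1. *)
Let avar_binomial t j : let y := extcol (Sigma t) j in
  let N := negpart y in
  [/\ cl (Sigma t) (avar j) = cl (mutate j (Sigma t)) (N - avar j) *
        (1 + cl (mutate j (Sigma t)) y), y (inr j) = 0 & N (inr j) = 0].
Proof.
move=> y N; have yj : y (inr j) = 0 := extcol_diag j (ss t).
have Nj : N (inr j) = 0 by rewrite ffunE yj oppr0 maxxx.
split=> //; rewrite (monoD (xmM t j)) (monoN (xmM t j)).
have := cmono_exchange j (A0 t); rewrite -/y -/N.
rewrite (cmono_mutate (Sigma t) yj) (cmono_mutate (Sigma t) Nj) => E.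
rewrite mulrAC -E; field; exact: (mono_neq0 (xmM t j)).
Qed.

Let subr_avar u i : (u - avar i) (inr i) = u (inr i) - 1.
Proof. by rewrite !ffunE eqxx. Qed.

(** Otherwise the variable at j would be invertible in the adjacent ring, and
    with it the binomial of avar_binomial. *)
Lemma unit_mono_exp_ge0 t j (c d : K) u : c * d = 1 ->
  laur (mutate j (Sigma t)) (scal F c * cl (Sigma t) u) -> 0 <= u (inr j).
Proof.
move=> cd lu; rewrite leNgt; apply/negP => uj.
have [aE yj Nj] := avar_binomial t j; set y := extcol _ _ in aE yj Nj.
set N := negpart y in aE Nj; set x' := cl (mutate j (Sigma t)) in aE *.
have x'M : monomial_map x' := xmM t j.
have la : laur (mutate j (Sigma t)) (cl (Sigma t) (- avar j)).
  rewrite (_ : - avar j = u + (- u - avar j)); last by rewrite addrA subrr add0r.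
  rewrite (monoD (xM t)) (_ : cl _ u = scal F d * (scal F c * cl (Sigma t) u)).
    apply: (lauM x'M); first by apply: (lauM x'M) => //; apply: lau_sc.
    by apply: laur_mutate; rewrite !ffunE eqxx; move: (u (inr j)) uj => b; lia.
  by rewrite mulrA -rmorphM mulrC [d * c]mulrC cd rmorph1 mulr1.
have [e ye] : exists e, y e != 0.
  have [//|H] := classic (exists e, y e != 0).
  case/eqP: (full_rank_neq0 j (@fr t)); apply/ffunP => e; rewrite -/y [RHS]ffunE.
  by apply/eqP; apply: contraT => ye; case: H; exists e.
have E : (1 + x' y) * (x' (N - avar j) * cl (Sigma t) (- avar j)) = 1.
  by rewrite mulrA [_ * x' _]mulrC -aE -(monoD (xM t)) subrr (mono0 (xM t)).
have : x' (N - avar j) * cl (Sigma t) (- avar j) = 0.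
  apply: (binomial_homog0 (@xm_free t j) x'M (coorD e) ye).
    by apply: (lauM x'M) => //; apply: lau_mono.
  by rewrite E -(mono0 x'M); apply: span_mono; rewrite /degeq ffunE.
by move/eqP; rewrite mulf_eq0 (negPf (mono_neq0 x'M _)) (negPf (mono_neq0 (xM t) _)).
Qed.

Lemma cmono_coef (A A' : 'I_n -> F) z : (forall i, z (inr i) = 0) ->
  cmono A z = cmono A' z.
Proof.
move=> z0; rewrite /cmono; congr (_ * _); apply: eq_bigr => i _.
by rewrite z0 !expr0z.
Qed.

(** In the Laurent ring of a cluster containing the variable both factors are
    monomials, with nonnegative exponents by unit_mono_exp_ge0; one of them
    then involves no cluster variable. *)
Lemma cluster_var_factor t k p q :
  upper (scal F) s0 p -> upper (scal F) s0 q -> p * q = seedA (Sigma t) k ->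
  exists c d z, [/\ c * d = 1, forall i, z (inr i) = 0 &
    p = scal F c * x0 z \/ q = scal F c * x0 z].
Proof.
move=> /(upperK t)[lp lp'] /(upperK t)[lq lq'] E.
rewrite -cmono_avar in E.
have [c [d [m [cd pE qE]]]] := mono_factor (@x_free t) (xM t) lp lq E.
have m0 i : 0 <= m (inr i).
  by apply: (unit_mono_exp_ge0 (t := t) cd); rewrite -pE.
have m1 i : 0 <= (avar k - m) (inr i).
  by apply: (unit_mono_exp_ge0 (t := t) (c := d) (d := c)); rewrite -?qE // mulrC.
have m1' i : m (inr i) <= (i == k)%:Z.
  by have := m1 i; rewrite !ffunE (inj_eq inr_inj); move: (m (inr i)) => b; case: (i == k); lia.
have mk : m (inr k) = 0 \/ m (inr k) = 1.
  by have := m0 k; have := m1' k; rewrite eqxx; move: (m (inr k)) => b; lia.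
case: mk => mk.
  have z0 i : m (inr i) = 0.
    have [->|ik] := eqVneq i k; first exact: mk.
    have := m0 i; have := m1' i; rewrite (negPf ik); move: (m (inr i)) => b; lia.
  by exists c, d, m; split=> //; left; rewrite pE (cmono_coef _ (seedA s0) z0).
have z0 i : (avar k - m) (inr i) = 0.
  rewrite !ffunE (inj_eq inr_inj); have [->|ik] := eqVneq i k; first by rewrite mk.
  have := m0 i; have := m1' i; rewrite (negPf ik); move: (m (inr i)) => b; lia.
exists d, c, (avar k - m); split=> //; first by rewrite mulrC.
by right; rewrite qE (cmono_coef _ (seedA s0) z0).
Qed.

(** A polynomial divisible by no variable is a monomial only if it is
    constant. *)
Lemma yeval_monomial_const f c u : c != 0 -> (forall j, f.@[all_but K j] != 0) ->
  yK f = scal F c * x0 u -> u = 0 /\ f = c%:MP.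
Proof.
move=> c0 fj E; have [m um fE] := yeval_monomial (@x_free t0) (xM t0) y0_inl c0 E.
have m0 : m = 0%MM.
  apply/mnmP => j; rewrite mnm0E; apply/eqP.
  have := fj j; rewrite fE mevalZ all_butX; case: (m j) => // m'.
  by rewrite mulr0 eqxx.
split; last by rewrite fE m0 mpolyX0 alg_mpolyC.
by apply/ffunP => e; rewrite um m0 yexpE ffunE big1 // => i _; rewrite mnm0E mul0r.
Qed.

Section ClusterVariable.
Variables (t : tree n) (k : 'I_n).
Hypothesis non_initial : forall i, seedA (Sigma t) k <> seedA s0 i.
Variables (g : 'I_n -> int) (fZ : {mpoly int[n]}).
Local Notation a := (seedA (Sigma t) k).
Local Notation fK := (map_mpoly intr fZ : {mpoly K[n]}).
Hypothesis fZ_pos : forall j, 0 < fZ.@[all_but int j].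
Hypothesis aZE : a = x0 (clusterexp g) * yeval (intF F) x0 y0 fZ.

Let fKE : fK = \sum_(m <- msupp fZ) (fZ@_m)%:~R *: 'X_[m].
Proof.
rewrite {1}[fZ]mpolyE (raddf_sum (map_mpoly intr)); apply: eq_bigr => m _.
by rewrite /= map_mpolyZ map_mpolyX.
Qed.

Lemma eval_intr j : fK.@[all_but K j] = (fZ.@[all_but int j])%:~R.
Proof.
rewrite fKE (raddf_sum (meval _)) {3}[fZ]mpolyE (raddf_sum (meval _)).
rewrite (raddf_sum intr); apply: eq_bigr => m _.
by rewrite /= !mevalZ !all_butX rmorphM rmorph_nat.
Qed.

Lemma yeval_intr : yeval (intF F) x0 y0 fZ = yK fK.
Proof.
rewrite fKE (raddf_sum yK) {1}[fZ]mpolyE (raddf_sum (yeval _ _ _)).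
apply: eq_bigr => m _; rewrite /= !yevalZ !(yeval_X _ _ (xM t0)).
by rewrite rmorph_int.
Qed.

Let aE : a = x0 (clusterexp g) * yK fK. Proof. by rewrite -yeval_intr. Qed.

Let fKj j : fK.@[all_but K j] != 0.
Proof. by rewrite eval_intr (intr_eq0 K_char0) gt_eqF. Qed.

Let upper_a : upper (scal F) s0 a.
Proof. apply: (upperK (t := t)); exact: (upper_cluster_var _ Sigma_pattern). Qed.

(** By the Laurent phenomenon over the integers the initial variable is an
    integral Laurent polynomial in the cluster at t, so q is invertible. *)
Lemma intr_unit_eq1 (q : int) i : 0 < q -> a = q%:~R * seedA s0 i -> q = 1.
Proof.
move=> q0 E.
have Z_free : lfree (intF F) (cl (Sigma t)) := intF_free K_char0 (ss t).2.
have U : upper (intF F) (Sigma t) (seedA s0 i).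
  apply: (upper_invariant (intF_free K_char0) Sigma_pattern fr0 (t := t0)).
  exact: (upper_cluster_var _ Sigma_pattern).
have [] := @mono_factor _ _ (intF F) _ (cl (Sigma t)) (intF F q) (seedA s0 i) (avar k) Z_free (xM t).
- exact: lau_sc.
- exact: U.1.
- by rewrite -E cmono_avar.
move=> c [d [m [cd qE _]]].
have [||_ qc] := @mono_inj _ _ (intF F) _ (cl (Sigma t)) Z_free q c 0 m.
  by rewrite gt_eqF.
  by rewrite (mono0 (xM t)) mulr1.
have {}cd : q * d = 1 by rewrite qc.
have d0 : 0 < d by nia.
by nia.
Qed.

(** Otherwise the quotient would lie in the upper cluster algebra, and by
    cluster_var_factor the cluster variable would be a unit times a monomial
    in the Z_j times the initial one. As no Z_j divides the F-polynomial, the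
    two variables would differ by a positive integer, which is 1 by
    intr_unit_eq1. *)
Lemma not_dvd_initial i : ~ laur (mutate i s0) (a * x0 (- avar i)).
Proof.
move=> la.
have Ua : upper (scal F) s0 (a * x0 (- avar i)).
  split; first by apply: (lauM (xM t0)); [exact: upper_a.1 | exact: lau_mono].
  move=> j; have [->//|ji] := eqVneq j i.
  apply: (lauM (xmM t0 j)); first exact: upper_a.2.
  by apply: laur_mutate; rewrite !ffunE (inj_eq inr_inj) (negPf ji).
have Ui : upper (scal F) s0 (x0 (avar i)).
  by rewrite cmono_avar; apply: (upper_cluster_var _ Sigma_pattern).
have [|c [d [z [cd z0 [E|E]]]]] := cluster_var_factor (t := t) (k := k) Ua Ui.
- by rewrite -mulrA -(monoD (xM t0)) addNr (mono0 (xM t0)) mulr1.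
- have c0 := unit_cancel cd.
  have {}E : a = scal F c * x0 (z + avar i).
    by rewrite (monoD (xM t0)) mulrA -E -mulrA -(monoD (xM t0)) addNr (mono0 (xM t0)) mulr1.
  have [|u0 fE] := @yeval_monomial_const fK c (z + avar i - clusterexp g) c0 fKj.
    apply: (mulfI (mono_neq0 (xM t0) (clusterexp g))); rewrite -aE E.
    by rewrite [RHS]mulrCA -(monoD (xM t0)) [clusterexp g + _]addrC subrK.
  have zi : z + avar i = clusterexp g by apply/eqP; rewrite -subr_eq0 u0.
  have zz : z = 0.
    apply/ffunP => -[] l; last by rewrite z0 ffunE.
    by have := congr1 (fun u : expo => u (inl l)) zi; rewrite !ffunE addr0.
  have cE : c = (fZ.@[all_but int i])%:~R by rewrite -eval_intr fE mevalC.
  have aq : a = (fZ.@[all_but int i])%:~R * seedA s0 i.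
    by rewrite E zz add0r cmono_avar cE rmorph_int.
  apply: (non_initial (i := i)).
  by rewrite aq (intr_unit_eq1 (fZ_pos i) aq) mul1r.
- have [|zi _] := @mono_inj _ _ (scal F) _ x0 (@x_free t0) 1 c (avar i) z (oner_neq0 _).
    by rewrite rmorph1 mul1r.
  by have := z0 i; rewrite -zi ffunE eqxx.
Qed.

Lemma fK_neq0 : fK != 0.
Proof. by apply: contraTneq (fKj k) => ->; rewrite meval0 eqxx. Qed.

(** If F were a unit, the cluster variable would be a unit times a monomial of
    the initial cluster. Its exponents are nonnegative, and they are not
    positive by not_dvd_initial, so it would be a coefficient. *)
Lemma fK_nonunit : fK \isn't a GRing.unit.
Proof.
apply/negP => /unitrPr[h fh].
have lf f : laur s0 (yK f) := span_lau (yeval_span (scal F) (xM t0) y0_inl f).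
have [|c [d [m [cd fE _]]]] := mono_factor (w := 0) (@x_free t0) (xM t0) (lf fK) (lf h).
  by rewrite -rmorphM fh rmorph1 (mono0 (xM t0)).
set w := clusterexp g + m.
have aM : a = scal F c * x0 w by rewrite aE fE [LHS]mulrCA -(monoD (xM t0)).
have w0 i : w (inr i) = 0.
  apply/eqP; rewrite eq_le; apply/andP; split; last first.
    by apply: (unit_mono_exp_ge0 (t := t0) cd); rewrite -aM; apply: upper_a.2.
  rewrite leNgt; apply/negP => wi; apply: (@not_dvd_initial i).
  rewrite aM -mulrA -(monoD (xM t0)); apply: (lauM (xmM t0 i)); first exact: lau_sc.
  by apply: laur_mutate; rewrite subr_avar; move: (w (inr i)) wi => b; lia.
have := aM; rewrite (cmono_coef _ (seedA (Sigma t)) w0) -cmono_avar => E.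
have [|kw _] := @mono_inj _ _ (scal F) _ (cl (Sigma t)) (@x_free t) 1 c (avar k) w (oner_neq0 _).
  by rewrite rmorph1 mul1r.
by have := w0 k; rewrite -kw ffunE eqxx.
Qed.

Let ex i (s : int) : expo := [ffun e => if e == inr i then s else 0].

(** The order s of f(y) along the initial variable at i is bounded below
    because some power of that variable clears all denominators, and above
    because the cluster variable would otherwise be divisible by it, against
    not_dvd_initial. *)
Lemma factor_order f h i : fK = f * h -> exists s : int,
  laur (mutate i s0) (x0 (ex i (- s)) * yK f) /\
  ~ laur (mutate i s0) (x0 (ex i (- (s + 1))) * yK f).
Proof.
move=> fh.
have clear f' : exists N : nat, laur (mutate i s0) (x0 (ex i N%:Z) * yK f').
  have ei : (avar i : expo) (inr i) = 1 by rewrite ffunE eqxx.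
  have P_free := @exchange_span K n F K (scal F) s0 i (ss t0) (seedA s0) (fun _ _ => erefl).
  have [N lN] := adj_clear (xM t0) (xmM t0 i) (coorD (inr i)) ei
    (@cmono_mutate K n F s0 i) (cmono_exchange i (A0 t0)) P_free
    (span_lau (yeval_span (scal F) (xM t0) y0_inl f')).
  exists N; rewrite (_ : ex i N%:Z = avar i *+ N) ?(monoMn (xM t0)) //.
  by apply/ffunP => e; rewrite ffunMnE !ffunE; case: (_ == _); lia.
have [N lN] := clear f; have [M lM] := clear h.
apply: NNPP => H.
have V (m : nat) : laur (mutate i s0) (x0 (ex i (N%:Z - m%:Z)) * yK f).
  elim: m => [|m IH]; first by rewrite subr0.
  apply: NNPP => nV; apply: H; exists (m%:Z - N%:Z); rewrite opprB; split=> //.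
  by rewrite (_ : - (_ + 1) = N%:Z - m.+1%:Z) //; lia.
set m := (absz (g i) + N + M + 1)%N.
apply: (@not_dvd_initial i); rewrite aE fh rmorphM /=.
rewrite (_ : _ * _ * _ = x0 (clusterexp g - avar i - ex i (N%:Z - m%:Z) - ex i M%:Z) *
  ((x0 (ex i (N%:Z - m%:Z)) * yK f) * (x0 (ex i M%:Z) * yK h))).
  apply: (lauM (xmM t0 i)); last exact: (lauM (xmM t0 i)).
  by apply: laur_mutate; rewrite !ffunE eqxx /m; lia.
rewrite !(monoD (xM t0)) !(monoN (xM t0)); field.
by rewrite !(mono_neq0 (xM t0)).
Qed.

(** A factor of F that is a unit times a monomial in the Z_j is constant, since
    no Z_j divides F. *)
Lemma factor_unit f h (c d : K) S z : fK = f * h -> c * d = 1 ->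
  x0 S * yK f = scal F c * x0 z -> f \is a GRing.unit.
Proof.
move=> fh cd E; have c0 := unit_cancel cd.
have [||_ ->] := @yeval_monomial_const f c (z - S) c0.
- move=> j; have := fKj j; rewrite fh mevalM mulf_eq0 negb_or => /andP[] //.
- apply: (mulfI (mono_neq0 (xM t0) S)); rewrite E.
  by rewrite [RHS]mulrCA -(monoD (xM t0)) [S + _]addrC subrK.
by apply: rmorph_unit; apply/unitrPr; exists d.
Qed.

(** Both factors are moved into the upper cluster algebra by their orders o1
    and o2; primality of the exchange binomials shows that these orders add up
    to the degree of the cluster variable, up to sign. *)
Lemma fK_factor f h : fK = f * h -> f \is a GRing.unit \/ h \is a GRing.unit.
Proof.
move=> fh; have hf : fK = h * f by rewrite mulrC.
have [o1 o1P] := fin_all_exists (fun i => factor_order i fh).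
have [o2 o2P] := fin_all_exists (fun i => factor_order i hf).
pose p1 := x0 (- clusterexp o1) * yK f; pose p2 := x0 (- clusterexp o2) * yK h.
have factorP f' (o : 'I_n -> int) (P : forall i,
    laur (mutate i s0) (x0 (ex i (- o i)) * yK f') /\
    ~ laur (mutate i s0) (x0 (ex i (- (o i + 1))) * yK f')) :
    upper (scal F) s0 (x0 (- clusterexp o) * yK f') /\
    forall i, ~ laur (mutate i s0) (x0 (- clusterexp o) * yK f' * x0 (- avar i)).
  split.
    split.
      apply: (lauM (xM t0)); first exact: lau_mono.
      exact: span_lau (yeval_span (scal F) (xM t0) y0_inl f').
    move=> i; rewrite (_ : _ * _ =
      x0 (- clusterexp o - ex i (- o i)) * (x0 (ex i (- o i)) * yK f')).
      apply: (lauM (xmM t0 i)); last exact: (P i).1.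
      by apply: laur_mutate; rewrite !ffunE eqxx; lia.
    by rewrite mulrA -(monoD (xM t0)) subrK.
  move=> i lo; apply: (P i).2.
  rewrite (_ : _ * _ = x0 (ex i (- (o i + 1)) + clusterexp o + avar i) *
      (x0 (- clusterexp o) * yK f' * x0 (- avar i))).
    apply: (lauM (xmM t0 i)) => //.
    by apply: laur_mutate; rewrite !ffunE !eqxx; lia.
  rewrite !(monoD (xM t0)) !(monoN (xM t0)); field.
  by rewrite !(mono_neq0 (xM t0)).
have [U1 nd1] := factorP f o1 o1P; have [U2 nd2] := factorP h o2 o2P.
rewrite -/p1 in U1 nd1; rewrite -/p2 in U2 nd2.
set w := clusterexp g + clusterexp o1 + clusterexp o2.
have aw : a = x0 w * (p1 * p2).
  rewrite aE fh rmorphM /= /p1 /p2 /w !(monoD (xM t0)) !(monoN (xM t0)); field.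
  by rewrite !(mono_neq0 (xM t0)).
have wl i : w (inl i) = 0 by rewrite !ffunE !addr0.
clearbody w; have w0 : w = 0.
  apply/ffunP => -[] i; first by rewrite wl ffunE.
  rewrite [RHS]ffunE; case: (ltgtP (w (inr i)) 0) => // wi; exfalso.
  (* A negative exponent makes p1 * p2 divisible by the prime binomial, hence
     one of p1 and p2; a positive one makes the cluster variable divisible. *)
  - pose b := a * x0 (- w - avar i).
    have lb : laur (mutate i s0) b.
      apply: (lauM (xmM t0 i)); first exact: upper_a.2.
      by apply: laur_mutate; rewrite subr_avar ffunE; move: (w (inr i)) wi => o; lia.
    have [xE yi Ni] := avar_binomial t0 i.
    set y := extcol _ _ in xE yi Ni; set N := negpart y in xE Ni.
    set x' := cl (mutate i s0) in xE.
    have x'M : monomial_map x' := xmM t0 i.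
    have pE : p1 * p2 = (1 + x' y) * (x' (N - avar i) * b).
      rewrite mulrA [_ * x' _]mulrC -xE /b aw !(monoD (xM t0)) !(monoN (xM t0)).
      by field; rewrite !(mono_neq0 (xM t0)).
    have dvd p r : laur (mutate i s0) r -> p = (1 + x' y) * r ->
        laur (mutate i s0) (p * x0 (- avar i)).
      move=> lh ->; rewrite (_ : _ * _ = x' (avar i - N) * r).
        by apply: (lauM x'M) => //; apply: lau_mono.
      apply: (mulIf (mono_neq0 (xM t0) (avar i))).
      rewrite (monoN (xM t0)) mulfVK ?(mono_neq0 (xM t0)) // xE.
      rewrite !(monoD x'M) !(monoN x'M); field.
      by rewrite !(mono_neq0 x'M).
    have yl : y (inl i) = 1 by rewrite y0_inl eqxx.
    have lh : laur (mutate i s0) (x' (N - avar i) * b).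
      by apply: (lauM x'M) => //; apply: lau_mono.
    have [[r lr E]|[r lr E]] := binomial_prime (@xm_free t0 i) x'M (coorD (inl i)) yl
      (U1.2 i) (U2.2 i) lh pE.
      exact: (nd1 i (dvd _ _ lr E)).
    exact: (nd2 i (dvd _ _ lr E)).
  - apply: (@not_dvd_initial i); rewrite aw mulrAC -(monoD (xM t0)).
    apply: (lauM (xmM t0 i)); last exact: (lauM (xmM t0 i)) (U1.2 i) (U2.2 i).
    by apply: laur_mutate; rewrite subr_avar; move: (w (inr i)) wi => o; lia.
have ap : p1 * p2 = a by rewrite aw w0 (mono0 (xM t0)) mul1r.
have [c [d [z [cd _ [E|E]]]]] := cluster_var_factor U1 U2 ap.
  by left; apply: (factor_unit fh cd E).
by right; apply: (factor_unit hf cd E).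
Qed.

(** The exponent M is large enough to clear all denominators of the Laurent
    expansion of the cluster variable. *)
Lemma value_at_one_fK : value_at_one (seedA s0) a fK.
Proof.
pose e m : expo := clusterexp g + yexp y0 m.
pose M i : nat := (\sum_(m <- msupp fK) absz (e m (inr i)))%N.
have leM m i : m \in msupp fK -> (absz (e m (inr i)) <= M i)%N.
  by move=> mf; rewrite /M (big_rem m) //= leq_addr.
pose mexp m : 'X_{1..n} := [multinom absz (e m (inr i) + (M i)%:Z)%R | i < n].
exists (\sum_(m <- msupp fK) (fK@_m *: 'X_[m] : {mpoly K[n]}) *: 'X_[mexp m]).
exists [multinom M i | i < n]; split; last first.
  rewrite raddf_sum /= {1}[fK]mpolyE; apply: eq_bigr => m _.
  rewrite mevalZ mevalX big1 ?mulr1 // => i _; exact: expr1n.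
rewrite {1}aE (yevalE _ _ (xM t0)) mulr_sumr mulr_suml.
rewrite (raddf_sum (mmap (polyZ F) (seedA s0))) big_seq [RHS]big_seq.
apply: eq_bigr => m mf; rewrite [RHS]mmapZ mmapX /mmap1.
rewrite [X in _ = X * _](_ : _ = scal F fK@_m * coef F (mon m)); last first.
  rewrite -[LHS]/(polyZ F (fK@_m *: 'X_[m])) [LHS]mmapZ -[mmap _ _ _]/(polyZ F 'X_[m]).
  by rewrite polyZE msuppX big_seq1 mcoeffX eqxx rmorph1 mul1r.
rewrite [x0 _ * _]mulrCA -(monoD (xM t0)) -/(e m) /cmono -!mulrA; congr (_ * (coef F _ * _)).
  by apply/ffunP => i; rewrite !ffunE add0r -(yexp_inl y0_inl).
rewrite -big_split /=; apply: eq_bigr => i _; rewrite !mnmE.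
rewrite -[_ ^+ M i]/(_ ^ (M i)%:Z) -expfzDr //.
have : 0 <= e m (inr i) + (M i)%:Z.
  by move: (leM m i mf); move: (e m (inr i)) => b; lia.
by case: (_ + _).
Qed.

End ClusterVariable.
End Irreducibility.

Theorem theorem6p2 (K : idomainType)
  (K_factorial : factorial_domain K) (K_char0 : [pchar K] =i pred0)
  (n : nat) (F : ambientField K (trop n))
  (Sigma : tree n -> seed_data F n) (Sigma_pattern : seed_pattern Sigma)
  (t0 : tree n) (Sigma_principal : principal_coefficients Sigma t0)
  (t : tree n) (k : 'I_n)
  (non_initial : forall i : 'I_n, cluster_var Sigma t k <> cluster_var Sigma t0 i) :
  irreducible (F_polynomial Sigma t0 t k).
Proof.
have [g [f [aE fj]]] := cluster_var_separated K_char0 Sigma_pattern Sigma_principal t k.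
have V := value_at_one_fK Sigma_pattern Sigma_principal aE.
have -> : F_polynomial Sigma t0 t k = map_mpoly intr f.
  apply: (value_at_one_inj (Sigma_pattern.1 t0).2 _ V).
  by apply: epsilon_spec; exists (map_mpoly intr f).
split.
- exact: (fK_neq0 K_char0 k fj).
- exact: (fK_nonunit K_char0 Sigma_pattern Sigma_principal non_initial fj aE).
- exact: (fK_factor K_char0 Sigma_pattern Sigma_principal non_initial fj aE).
Qed.
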